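(* Let $n\ge1$. A. For all $1\le q,r,p,b,c\le\infty$ the following three estimates are equivalent: $$\|U(t)f\|_{L^q_tL^r_xL^p_v}\lesssim\|f\|_{L^b_xL^c_v}\quad\text{for all } f\in L^b_xL^c_v;$$ $$\|W(t)F\|_{L^q_tL^r_xL^p_v}\lesssim\|F\|_{L^1_tL^b_xL^c_v}\quad\text{for all } F\in L^1_tL^b_xL^c_v;$$ $$\|W(t)F\|_{L^\infty_tL^{b'}_xL^{c'}_v}\lesssim\|F\|_{L^{q'}_tL^{r'}_xL^{p'}_v}\quad\text{for all } F\in L^{q'}_tL^{r'}_xL^{p'}_v.$$ B. When $b=c=2$ and $p=r'$, the first estimate, i.e. $\|U(t)f\|_{L^q_tL^r_xL^{r'}_v}\lesssim\|f\|_{L^2_{x,v}}$ for all $f\in L^2_{x,v}$, is equivalent to $$\|W(t)F\|_{L^q_tL^r_xL^{r'}_v}\lesssim\|F\|_{L^{q'}_tL^{r'}_xL^r_v}\quad\text{for all } F\in L^{q'}_tL^{r'}_xL^r_v.$$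
   Context: $U(t)f(x,v)=f(x-tv,v)$ for $f$ on $\mathbb R^n\times\mathbb R^n$, and $W(t)F=\int_{-\infty}^tU(t-s)F(s)\,ds$ for $F$ on $\mathbb R\times\mathbb R^n\times\mathbb R^n$. $L^q_tL^r_xL^p_v=L^q(\mathbb R;L^r(\mathbb R^n;L^p(\mathbb R^n)))$, $L^b_xL^c_v=L^b(\mathbb R^n;L^c(\mathbb R^n))$, $L^2_{x,v}=L^2(\mathbb R^{2n})$. A prime denotes the Hölder conjugate exponent. $\lesssim$ means $\le$ up to a constant independent of $f$, respectively $F$. *)

(* Defs.v *)
From HB Require Import structures.
From mathcomp Require Import all_boot all_order all_algebra.
From mathcomp Require Import all_classical all_reals all_analysis.

Set Implicit Arguments.
Unset Strict Implicit.
Unset Printing Implicit Defensive.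
Import Order.TTheory GRing.Theory Num.Theory.
Import numFieldNormedType.Exports.

Local Open Scope classical_set_scope.
Local Open Scope ring_scope.

(* R^n carries the sigma-algebra generated by the n coordinates, i.e. the
   Borel one. *)
Notation Rn R n := (n.-tuple (measurableTypeR R)).

Section lebesgue_step.
Context {R : realType} {n : nat}.

Definition cons_pair (z : measurableTypeR R * Rn R n) : Rn R n.+1 :=
  [tuple of z.1 :: z.2].

Lemma measurable_cons_pair : measurable_fun [set: _] cons_pair.
Proof. exact: measurable_cons. Qed.

Definition uncons_pair (x : Rn R n.+1) : measurableTypeR R * Rn R n :=
  (tnth x ord0, [tuple of behead x]).

Lemma measurable_uncons_pair : measurable_fun [set: _] uncons_pair.
Proof.
apply: measurable_fun_pair; first exact: measurable_tnth.
exact: measurable_behead.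
Qed.

Lemma cons_pairK : cancel cons_pair uncons_pair.
Proof. by move=> [a x]; congr pair; apply/val_inj. Qed.

Lemma uncons_pairK : cancel uncons_pair cons_pair.
Proof. by move=> x; rewrite [RHS]tuple_eta; apply/val_inj. Qed.

Let measurable_preimage_cons A :
  measurable A -> measurable (cons_pair @^-1` A).
Proof.
by move=> mA; rewrite -[X in measurable X]setTI; exact: measurable_cons_pair.
Qed.

Variable m : {sigma_finite_measure set (Rn R n) -> \bar R}.

Definition lebesgue_step : set (Rn R n.+1) -> \bar R :=
  pushforward (@lebesgue_measure R \x m)%E cons_pair.

Let step0 : lebesgue_step set0 = 0%E.
Proof. by rewrite /lebesgue_step /pushforward preimage_set0 measure0. Qed.

Let step_ge0 A : (0 <= lebesgue_step A)%E.
Proof. by rewrite /lebesgue_step /pushforward; exact: measure_ge0. Qed.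

Let step_sigma_additive : semi_sigma_additive lebesgue_step.
Proof.
move=> F mF tF mUF; rewrite /lebesgue_step /pushforward preimage_bigcup.
apply: measure_semi_sigma_additive.
- by move=> k; exact: measurable_preimage_cons.
- apply/trivIsetP => /= i j _ _ ij; rewrite -preimage_setI.
  by move/trivIsetP : tF => /(_ _ _ _ _ ij) ->//; rewrite preimage_set0.
- by rewrite -preimage_bigcup; exact: measurable_preimage_cons.
Qed.

HB.instance Definition _ := isMeasure.Build _ _ _ lebesgue_step
  step0 step_ge0 step_sigma_additive.

Let step_sigma_finite : sigma_finite [set: _] lebesgue_step.
Proof.
have /sigma_finiteP[F [TF ndF Foo]] := sigma_finiteT (@lebesgue_measure R).
have /sigma_finiteP[G [TG ndG Goo]] := sigma_finiteT m.
exists (fun k => uncons_pair @^-1` (F k `*` G k)).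
  rewrite -preimage_bigcup -[LHS](preimage_setT uncons_pair); congr preimage.
  rewrite -setXTT TF TG predeqE => -[x y]; split.
    move=> [/= [i _ Fix] [j _ Gjy]]; exists (maxn i j) => //; split.
    - by move: x Fix; exact/subsetPset/ndF/leq_maxl.
    - by move: y Gjy; exact/subsetPset/ndG/leq_maxr.
  by move=> [i _ []/= ? ?]; split; exists i.
move=> k; have [mFk Fkoo] := Foo k; have [mGk Gkoo] := Goo k; split.
  rewrite -[X in measurable X]setTI; apply: measurable_uncons_pair => //.
  exact: measurableX.
rewrite /lebesgue_step /pushforward -comp_preimage.
rewrite (_ : uncons_pair \o cons_pair = id); last first.
  by apply/funext => z; exact: cons_pairK.
by rewrite preimage_id product_measure1E// lte_mul_pinfty// ge0_fin_numE.
Qed.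

HB.instance Definition _ := Measure_isSigmaFinite.Build _ _ _ lebesgue_step
  step_sigma_finite.

End lebesgue_step.

Fixpoint lebesgue_Rn (R : realType) (n : nat) :
    {sigma_finite_measure set (Rn R n) -> \bar R} :=
  match n with
  | 0 => dirac ([tuple] : Rn R 0)
  | n'.+1 => lebesgue_step (lebesgue_Rn R n')
  end.

Lemma lebesgue_Rn_box (R : realType) (n : nat)
    (A : 'I_n -> set (measurableTypeR R)) : (forall i, measurable (A i)) ->
  lebesgue_Rn R n [set x | forall i, A i (tnth x i)] =
    (\prod_(i < n) lebesgue_measure (A i))%E.
Proof.
elim: n => [|n ih] in A * => mA.
  rewrite big_ord0 /= /dirac indicE mem_set// => -[]//.
rewrite big_ord_recl /= /lebesgue_step /pushforward -ih//.
rewrite -[RHS]product_measure1E//; last first.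
  rewrite (_ : [set _ | _] = \big[setI/setT]_(i < n)
      ((fun x : Rn R n => tnth x i) @^-1` A (lift ord0 i))).
    apply: bigsetI_measurable => i _; rewrite -[X in measurable X]setTI.
    exact: measurable_tnth.
  by rewrite -bigcap_seq; apply/seteqP; split => x /= h i;
    [move=> _|]; apply: h => /=; rewrite ?mem_index_enum.
congr (_ _); apply/seteqP; split=> -[a x] /= h.
  by split => [|i] /=; [exact: (h ord0)|]; have := h (lift ord0 i); rewrite /cons_pair tnthS.
move=> i; case: (unliftP ord0 i) => [j|] ->; last exact: h.1.
by rewrite /cons_pair tnthS; exact: h.2.
Qed.

(* Functions are real-valued and measurable for the product of the Borel
   sigma-algebras; the mixed norms are iterated Lebesgue norms, the rightmost
   exponent being the innermost one.  They are defined on extended-real-valued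
   functions because [W F] below is one. *)
Section mixed_norms.
Context {R : realType} {n : nat}.
Local Notation X := (Rn R n * Rn R n)%type.

Definition norm_xv (b c : \bar R) (f : X -> \bar R) : \bar R :=
  Lnorm (lebesgue_Rn R n) b
    (fun x => Lnorm (lebesgue_Rn R n) c (fun v => f (x, v))).

Definition norm_txv (q r p : \bar R) (F : R -> X -> \bar R) : \bar R :=
  Lnorm (@lebesgue_measure R) q (fun t => norm_xv r p (F t)).

Definition L_xv (b c : \bar R) : set (X -> R) :=
  [set f | measurable_fun [set: X] f /\ (norm_xv b c (EFin \o f) < +oo)%E].

Definition L_txv (q r p : \bar R) : set (R -> X -> R) :=
  [set F | measurable_fun [set: measurableTypeR R * X] (uncurry F) /\
           (norm_txv q r p (fun t => EFin \o F t) < +oo)%E].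

End mixed_norms.

Definition lesssim {R : realType} {T : Type} (D : set T) (N M : T -> \bar R) :=
  exists2 C : R, 0 < C & forall f, D f -> (N f <= C%:E * M f)%E.

Section transport.
Context {R : realType} {n : nat}.
Local Notation X := (Rn R n * Rn R n)%type.

Definition U (t : R) (f : X -> R) : X -> R := fun z =>
  f ([tuple (tnth z.1 i : R) - t * (tnth z.2 i : R) | i < n], z.2).

(* Where the integral does not converge absolutely its value is +oo or -oo
   (+oo - +oo being -oo), so that a finite mixed norm of [W F] contains the
   almost everywhere convergence of the integral. *)
Definition W (F : R -> X -> R) (t : R) : X -> \bar R := fun z =>
  (\int[@lebesgue_measure R]_(s in [set s | (s <= t)%R])
     (U (t - s) (F s) z)%:E)%E.

End transport.

(* Main.v *)
(* All estimates reduce to nonnegative functions, and by duality of the mixed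
   norms (measurable norming sequences, one variable at a time) to bounds for
   forms.  With [B(s,t) = <U(t-s)F(s), G(t)>], the inhomogeneous estimates bound
   the causal form, the integral of [B] over [s <= t], on [L^1 L^b L^c] times
   the dual of [L^q L^r L^p], in one order or the other; the reflection
   [(t,x,v) -> (-t,x,-v)] exchanges the orders.  Since [B] is symmetric under
   [(F,s) <-> (G,t)], the integral of [B] over all [s, t] is then bounded too.
   Invariance under time translation derives this full bound from the
   homogeneous estimate, while testing it on [F(s) = phi_k(s) f], with [phi_k]
   concentrating at [0], gives back the homogeneous estimate by Lebesgue
   differentiation and Fatou's lemma; this covers all endpoint exponents.  On
   [L^2], with [T^*G] the integral of [U(-t)G(t)], the full form is
   [<T^*F, T^*G>], whence part B by the TT^* argument. *)
From HB Require Import structures.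
Require Import Defs.
From mathcomp Require Import all_boot all_order all_algebra.
From mathcomp Require Import all_classical all_reals all_analysis.
From mathcomp Require Import ess_sup_inf measurable_realfun.

Set Implicit Arguments.
Unset Strict Implicit.
Unset Printing Implicit Defensive.
Import Order.TTheory GRing.Theory Num.Theory.
Import numFieldNormedType.Exports.

Local Open Scope classical_set_scope.
Local Open Scope ring_scope.
Local Open Scope ereal_scope.

(** * Lebesgue norms *)

(** What makes causality harmless here is the positivity of [U]. For nonnegative functions, cutting
    the form down to [s <= t] can only decrease it, and the full form is at most the sum of the two
    causal ones; no lemma of Christ-Kiselev type, with its restriction on the exponents, intervenes.
    Positivity also lets every exchange of integrals be Tonelli's and every limit be monotone
    convergence or Fatou, with values in [[0, +oo]]. Because the norms are iterated, a norming
    function for an inner variable has to be jointly measurable in the outer ones. It is therefore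
    taken from an explicit countable family: powers of truncations for a finite exponent, normalised
    indicators of level sets for [+oo]. The pulses [phi_k(s) f] are admissible test functions
    because the time exponent is 1: their norm is that of [f] for every [k], although they
    concentrate. Lebesgue differentiation is applied along the trajectories of a bounded [f]; a
    truncation removes the bound. *)

Section Lnorm_order.
Context d (T : measurableType d) (R : realType).
Variable mu : {measure set T -> \bar R}.
Implicit Types f g : T -> \bar R.

(** The integral of a nonnegative function is a supremum over the nonnegative simple functions below
    it, and [f <= g] enlarges this set. *)
Lemma ge0_le_integralT f g : (forall x, 0 <= f x) -> (forall x, f x <= g x) ->
  \int[mu]_x f x <= \int[mu]_x g x.
Proof.
move=> f0 fg; have g0 x : 0 <= g x by exact: le_trans (fg x).
rewrite !ge0_integralTE//; apply: ereal_sup_le => _ [h /= hf <-].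
by exists h => // x; exact: le_trans (fg x).
Qed.

(** When the whole space has measure 0, [Lnorm] at [+oo] is 0 by convention, and both sides hold;
    otherwise it is the essential supremum. *)
Lemma Lnorm_y_leP f (M : \bar R) : 0 <= M ->
  Lnorm mu +oo f <= M <-> \forall x \ae mu, `|f x| <= M.
Proof.
move=> M0; rewrite unlock /Lnorm; case: ifPn => [_|].
  by split => [/ess_supP//|h]; apply/ess_supP.
rewrite -leNgt => muT0; split => // _.
have {}muT0 : mu setT = 0 by apply/eqP; rewrite eq_le muT0 measure_ge0.
by exists setT; split.
Qed.

Lemma le_Lnorm p f g : 1 <= p -> (forall x, `|f x| <= `|g x|) ->
  Lnorm mu p f <= Lnorm mu p g.
Proof.
case: p => [p||//] p1 fg; last first.
  apply: (Lnorm_y_leP f (Lnorm_ge0 mu +oo g)).2.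
  have := (Lnorm_y_leP g (Lnorm_ge0 mu +oo g)).1 (lexx _).
  by apply: filterS => x; exact: le_trans.
have p0 : (0 <= p)%R by rewrite (le_trans ler01).
rewrite unlock /Lnorm gt0_ler_poweR ?invr_ge0//= ?in_itv/= ?leey ?andbT//.
- by apply: integral_ge0 => *; exact: poweR_ge0.
- by apply: integral_ge0 => *; exact: poweR_ge0.
apply: ge0_le_integralT => x; first exact: poweR_ge0.
by apply: gt0_ler_poweR; rewrite //= in_itv/= abse_ge0 leey.
Qed.

Lemma ge0_LnormZ p (c : R) f : 1 <= p -> (0 <= c)%R -> measurable_fun setT f ->
  Lnorm mu p (fun x => c%:E * f x) = c%:E * Lnorm mu p f.
Proof.
case: p => [p||//] p1 c0 mf; last first.
  rewrite unlock /Lnorm; case: ifPn => [muT|]; last by rewrite mule0.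
  rewrite -ess_supZl//; congr ess_sup; apply/funext => x /=.
  by rewrite abseM gee0_abs.
have p0 : (0 < p)%R by rewrite (lt_le_trans ltr01).
rewrite unlock /Lnorm; under eq_integral do
  rewrite abseM gee0_abs ?lee_fin// poweRM// poweR_EFin.
rewrite ge0_integralZl//; last 3 first.
- apply: (@measurableT_comp _ _ _ _ _ _ (fun x => x `^ p)) => //=.
    exact: (measurableT_comp (measurable_poweR _)).
  exact: measurableT_comp.
- by move=> *; exact: poweR_ge0.
- by rewrite lee_fin powR_ge0.
rewrite poweRM ?lee_fin ?powR_ge0//; last by apply: integral_ge0 => *; exact: poweR_ge0.
by rewrite -poweR_EFin -poweRrM mulfV ?gt_eqF// poweRe1.
Qed.

End Lnorm_order.

Section hoelder_ereal.
Context d (T : measurableType d) (R : realType).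
Variable mu : {measure set T -> \bar R}.
Implicit Types f g : T -> \bar R.

Lemma measurable_abse_poweR d' (T' : measurableType d') (p : R)
    (f : T' -> \bar R) :
  measurable_fun setT f -> measurable_fun setT (fun x => `|f x| `^ p).
Proof.
move=> mf; apply: (@measurableT_comp _ _ _ _ _ _ (fun x => x `^ p)) => //=.
  exact: (measurableT_comp (measurable_poweR _)).
exact: measurableT_comp.
Qed.

Lemma ae_mul_ge0_le f g (M : \bar R) :
  measurable_fun setT f -> measurable_fun setT g ->
  (forall x, 0 <= f x) -> (forall x, 0 <= g x) -> 0 <= M ->
  (\forall x \ae mu, g x <= M) ->
  \int[mu]_x (f x * g x) <= (\int[mu]_x f x) * M.
Proof.
move=> mf mg f0 g0 M0 gM; rewrite -ge0_integralZr//.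
apply: ae_ge0_le_integral => //.
- by move=> x _; rewrite mule_ge0.
- exact: emeasurable_funM.
- by move=> x _; rewrite mule_ge0.
- by apply: emeasurable_funM.
- by apply: filterS gM => x gM _; rewrite lee_wpmul2l.
Qed.

Lemma ge0_integral_eq0_mul f g :
  measurable_fun setT f -> measurable_fun setT g ->
  f = \0 %[ae mu] -> \int[mu]_x (f x * g x) = 0.
Proof.
move=> mf mg f0; rewrite (ae_eq_integral (cst 0)) ?integral0//.
  exact: emeasurable_funM.
by apply: filterS f0 => x + _ => /(_ I) /= ->; rewrite mul0e.
Qed.

(** Lets extended-valued functions of finite norm be replaced by their real parts in Hölder's
    inequality. *)
Lemma Lnorm_lty_fin_num (p : R) f : (0 < p)%R -> measurable_fun setT f ->
  Lnorm mu p%:E f < +oo -> \forall x \ae mu, f x \is a fin_num.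
Proof.
move=> p0 mf; have pn0 : p != 0%R by rewrite gt_eqF.
rewrite unlock /Lnorm => /(lty_poweRy (invr_neq0 pn0)) foo.
have : mu.-integrable setT (fun x => `|f x| `^ p).
  apply/integrableP; split; first exact: measurable_abse_poweR.
  by under eq_integral do rewrite gee0_abs ?poweR_ge0//.
move=> /(integrable_ae measurableT); apply: filterS => x /(_ I).
by rewrite ge0_fin_numE ?poweR_ge0// fin_num_abs => /(lty_poweRy pn0).
Qed.

(** The endpoints are almost everywhere bounds. For [1 < p < +oo], settling the norms 0 and [+oo]
    first leaves functions that are finite almost everywhere, and Hölder for real-valued functions
    applies to [fine \o f] and [fine \o g]. *)
Lemma ge0_hoelder p f g : 1 <= p ->
  measurable_fun setT f -> measurable_fun setT g ->
  (forall x, 0 <= f x) -> (forall x, 0 <= g x) ->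
  \int[mu]_x (f x * g x) <=
    Lnorm mu p f * Lnorm mu (hoelder_conjugate p) g.
Proof.
have hoelder1y f' g' : measurable_fun setT f' -> measurable_fun setT g' ->
    (forall x, 0 <= f' x) -> (forall x, 0 <= g' x) ->
    \int[mu]_x (f' x * g' x) <= Lnorm mu 1 f' * Lnorm mu +oo g'.
  move=> mf mg f0 g0; rewrite Lnorm1.
  under [in leRHS]eq_integral do rewrite gee0_abs//.
  apply: ae_mul_ge0_le => //; first exact: Lnorm_ge0.
  have := (Lnorm_y_leP mu g' (Lnorm_ge0 mu +oo g')).1 (lexx _).
  by apply: filterS => x; rewrite gee0_abs.
case: p => [p||//] p1 mf mg f0 g0; last first.
  rewrite hoelder_conjugatey muleC.
  by under eq_integral do rewrite muleC; exact: hoelder1y.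
have [->|pneq1] := eqVneq p 1%R; first by rewrite hoelder_conjugate1 hoelder1y.
have {p1 pneq1}p1 : (1 < p)%R by rewrite lt_neqAle eq_sym pneq1.
have p0 : (0 < p)%R by rewrite (lt_trans ltr01).
pose q := (p / (p - 1))%R.
have qE : hoelder_conjugate p%:E = q%:E.
  rewrite /hoelder_conjugate/= eqe gt_eqF// -EFinB inver subr_eq0 gt_eqF//.
have q0 : (0 < q)%R by rewrite divr_gt0// subr_gt0.
have pq : (p^-1 + q^-1 = 1)%R.
  by rewrite /q invf_div -{1}(div1r p) -mulrDl subrKC mulfV// gt_eqF.
rewrite qE.
(* Since [0 * +oo] is 0, a vanishing norm makes the right side 0 whatever the other norm is, so the
   integral itself must vanish. *)
have [f00|fn0] := eqVneq (Lnorm mu p%:E f) 0.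
  rewrite f00 mul0e ge0_integral_eq0_mul//.
  by apply: (Lnorm_eq0_eq0 mf _ f00); rewrite lte_fin.
have [g00|gn0] := eqVneq (Lnorm mu q%:E g) 0.
  under eq_integral do rewrite muleC.
  rewrite g00 mule0 ge0_integral_eq0_mul//.
  by apply: (Lnorm_eq0_eq0 mg _ g00); rewrite lte_fin.
have fpos : 0 < Lnorm mu p%:E f by rewrite lt0e fn0 Lnorm_ge0.
have gpos : 0 < Lnorm mu q%:E g by rewrite lt0e gn0 Lnorm_ge0.
have [foo|foo] := eqVneq (Lnorm mu p%:E f) +oo; first by rewrite foo gt0_mulye ?leey.
have [goo|goo] := eqVneq (Lnorm mu q%:E g) +oo; first by rewrite goo gt0_muley ?leey.
have aef : \forall x \ae mu, f x \is a fin_num.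
  by apply: (Lnorm_lty_fin_num p0) => //; rewrite ltey.
have aeg : \forall x \ae mu, g x \is a fin_num.
  by apply: (Lnorm_lty_fin_num q0) => //; rewrite ltey.
have mff : measurable_fun setT (fine \o f) by exact: measurableT_comp.
have mgf : measurable_fun setT (fine \o g) by exact: measurableT_comp.
have fine_le (y : \bar R) : `|(fine y)%:E| <= `|y|.
  by case: y => [r||]; rewrite /= ?normr0 ?leey ?lexx.
have le1 : Lnorm mu p%:E (EFin \o (fine \o f)) <= Lnorm mu p%:E f.
  by apply: le_Lnorm => [|x]; [rewrite lee_fin ltW|exact: fine_le].
have le2 : Lnorm mu q%:E (EFin \o (fine \o g)) <= Lnorm mu q%:E g.
  apply: le_Lnorm => [|x]; [|exact: fine_le].
  by rewrite lee_fin /q ler_pdivlMr ?subr_gt0// mul1r gerBl.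
apply: le_trans (lee_pmul (Lnorm_ge0 _ _ _) (Lnorm_ge0 _ _ _) le1 le2).
apply: le_trans (hoelder mu mff mgf p0 q0 pq).
rewrite Lnorm1.
rewrite (ae_eq_integral (fun x => `|(((fine \o f) \* (fine \o g)) x)%:E|)) //.
- exact: emeasurable_funM.
- apply: measurableT_comp => //; apply/measurable_EFinP.
  exact: measurable_funM.
- apply: filterS2 aef aeg => x fx gx _ /=.
  rewrite ger0_norm ?mulr_ge0 ?fine_ge0// EFinM !fineK//.
Qed.

End hoelder_ereal.

Section measure_preserving.
Context d (T : measurableType d) (R : realType).
Variable mu : {measure set T -> \bar R}.

Definition measure_preserving (phi : T -> T) :=
  measurable_fun setT phi /\
  forall A, measurable A -> mu (phi @^-1` A) = mu A.

Variable phi : T -> T.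
Hypothesis mphi : measure_preserving phi.

Lemma measure_preserving_integral (f : T -> \bar R) :
  measurable_fun setT f -> (forall x, 0 <= f x) ->
  \int[mu]_x f (phi x) = \int[mu]_x f x.
Proof.
move=> mf f0; have [mphi1 phiE] := mphi.
transitivity (\int[pushforward mu phi]_x f x).
  by rewrite ge0_integral_pushforward// preimage_setT.
by apply: eq_measure_integral => A mA _; exact: phiE.
Qed.

Lemma measure_preserving_Lnorm p (f : T -> \bar R) : 1 <= p ->
  measurable_fun setT f -> Lnorm mu p (fun x => f (phi x)) = Lnorm mu p f.
Proof.
case: p => [p||//] p1 mf; rewrite unlock /Lnorm.
  congr (_ `^ _); apply: (measure_preserving_integral (f := fun x => `|f x| `^ p)).
    exact: measurable_abse_poweR.
  by move=> x; exact: poweR_ge0.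
have [mphi1 phiE] := mphi.
(* At [+oo] the norm is the infimum of the levels whose superlevel set is null, and [phi] preserves
   the measure of these sets. *)
case: ifPn => // muT; rewrite !ess_supEmu0//; last 2 first.
- exact: measurableT_comp.
- by apply: measurableT_comp => //; exact: measurableT_comp.
have E y : mu ((abse \o (fun x => f (phi x))) @^-1` `]y, +oo[) =
           mu ((abse \o f) @^-1` `]y, +oo[).
  apply: phiE; rewrite -[X in measurable X]setTI.
  by apply: measurableT_comp => //; exact: emeasurable_itv.
by congr (ereal_inf _); apply/seteqP; split => y /=; rewrite E.
Qed.

End measure_preserving.

Section measurable_Lnorm.
Context d1 d2 (Y : measurableType d1) (Z : measurableType d2) (R : realType).
Variable nu : {sigma_finite_measure set Z -> \bar R}.

(** For finite [p] this is Tonelli. At [+oo] the norm exceeds [a] exactly where the section of the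
    set [|h| > a] has positive measure, and that measure is a measurable function of [y]. *)
Lemma measurable_Lnorm p (h : Y * Z -> \bar R) : 1 <= p ->
  measurable_fun setT h ->
  measurable_fun setT (fun y => Lnorm nu p (fun z => h (y, z))).
Proof.
case: p => [p||//] p1 mh; rewrite unlock /Lnorm.
  apply: (@measurableT_comp _ _ _ _ _ _ (fun x => x `^ p^-1)) => //=.
    exact: (measurableT_comp (measurable_poweR _)).
  apply: (measurable_fun_fubini_tonelli_F (fun w => `|h w| `^ p)) => //.
    exact: measurable_abse_poweR.
  by move=> *; exact: poweR_ge0.
case: (boolP (0 < nu setT)) => // nuT; apply: (measurability
    _ (ErealGenOInfty.measurableE R)).
move=> /= _ [_ [a ->]] <-; rewrite setTI.
pose B := (abse \o h) @^-1` `]a%:E, +oo[.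
have mB : measurable B.
  rewrite -[B]setTI; apply: measurableT_comp => //; exact: emeasurable_itv.
rewrite (_ : _ @^-1` _ = [set y | 0 < nu (xsection B y)]).
  rewrite -[X in measurable X]setTI; apply: emeasurable_fun_o_infty => //.
  exact: measurable_fun_xsection.
apply/seteqP; split => y /=; rewrite in_itv/= ?andbT !ltNge; apply: contra => ay.
  apply/ess_supP/ae_le_measureP; first exact/measurableT_comp/measurableT_comp.
  by apply/eqP; rewrite eq_le measure_ge0 andbT; move: ay; rewrite xsectionE.
move/ess_supP : ay => /ae_le_measureP; rewrite xsectionE => <- //.
exact/measurableT_comp/measurableT_comp.
Qed.

End measurable_Lnorm.

(** * Norming sequences and duality *)

Lemma le_poweR (R : realType) (r : R) (x y : \bar R) : (0 <= r)%R -> 0 <= x ->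
  x <= y -> x `^ r <= y `^ r.
Proof.
move=> r0 x0 xy; apply: gt0_ler_poweR => //; rewrite in_itv/= leey andbT//.
exact: le_trans xy.
Qed.

Section norming.
Context d1 d2 (Y : measurableType d1) (Z : measurableType d2) (R : realType).
Variable nu : {sigma_finite_measure set Z -> \bar R}.

(** Joint measurability in [(y, z)] is what allows such functions to be multiplied across the
    variables of an iterated norm. *)
Definition unit_section (q : \bar R) (g : Y * Z -> R) :=
  [/\ measurable_fun setT g, (forall w, 0 <= g w)%R &
      forall y, Lnorm nu q (fun z => (g (y, z))%:E) <= 1].

Variable h : Y * Z -> \bar R.
Hypothesis mh : measurable_fun setT h.
Hypothesis h0 : forall w, 0 <= h w.

Let I (g : Y * Z -> R) (y : Y) := \int[nu]_z (h (y, z) * (g (y, z))%:E).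

Let mI (g : Y * Z -> R) : measurable_fun setT g -> (forall w, 0 <= g w)%R ->
  measurable_fun setT (I g).
Proof.
move=> mg g0.
apply: (measurable_fun_fubini_tonelli_F (fun w => h w * (g w)%:E)) => //.
  by apply: emeasurable_funM => //; exact/measurable_EFinP.
by move=> w; rewrite mule_ge0// lee_fin.
Qed.

(* Gluing along the sections where the new pairing is larger keeps each
   section in the unit ball and makes the pairings nondecreasing. *)
Lemma unit_section_nondecreasing q (g : nat -> Y * Z -> R) :
  (forall k, unit_section q (g k)) ->
  exists G : nat -> Y * Z -> R, [/\ forall k, unit_section q (G k),
    forall y, nondecreasing_seq (fun k => I (G k) y) &
    forall k y, I (g k) y <= I (G k) y].
Proof.
move=> ug.
pose G := fix G k : Y * Z -> R := if k is k'.+1 then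
  fun w => if I (G k') w.1 < I (g k) w.1 then g k w else G k' w else g 0%N.
have IGS k y : I (G k.+1) y = Order.max (I (G k) y) (I (g k.+1) y).
  by rewrite {1}/I /=; case: ltP => // _; exact: eq_integral.
exists G; split.
- elim=> [|k [mG G0 NG]]; first exact: ug.
  have [mg g0 Ng] := ug k.+1; split=> [|w|y] /=.
  + apply: measurable_fun_ifT => //; apply: measurable_fun_lte.
      by apply: measurableT_comp => //; exact: mI.
    by apply: measurableT_comp => //; exact: mI.
  + by case: ifP.
  + by case: (I (G k) y < _).
- by move=> y; apply/nondecreasing_seqP => k; rewrite IGS le_max lexx.
- by move=> [|k] y //; rewrite IGS le_max lexx orbT.
Qed.

(** The half of duality that Hölder does not give, with one countable family serving all [y] at
    once, including those where the norm is infinite. *)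
Definition norming p := exists g : nat -> Y * Z -> R,
  (forall k, unit_section (hoelder_conjugate p) (g k)) /\
  forall y, Lnorm nu p (fun z => h (y, z)) <= ereal_sup (range (fun k => I (g k) y)).

Let norming1 : norming 1.
Proof.
exists (fun _ => cst 1%R); split => [_|y].
  split => // y; rewrite hoelder_conjugate1; apply: (Lnorm_y_leP _ _ lee01).2.
  by apply: nearW => z; rewrite /= normr1.
apply: le_ereal_sup_tmp; exists (I (cst 1%R) y); first by exists 0%N.
rewrite Lnorm1 /I; under [in leRHS]eq_integral do rewrite mule1.
by under eq_integral do rewrite gee0_abs//.
Qed.

(** The extremal function of Hölder's inequality, [h^(p-1)] divided by the power [p-1] of the norm
    of [h], taken for the truncations [hk] of [h] to height [k] and to a set of finite measure.
    Monotone convergence in [k] recovers [h]. *)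
Let norming_fin (p : R) : (1 < p)%R -> norming p%:E.
Proof.
move=> p1; have p0 : (0 < p)%R by rewrite (lt_trans ltr01).
have [E [TE ndE Eoo]] := (sigma_finiteP _ _).1 (sigma_finiteT nu).
pose q := (p / (p - 1))%R.
have qE : hoelder_conjugate p%:E = q%:E.
  by rewrite /hoelder_conjugate/= eqe gt_eqF// -EFinB inver subr_eq0 gt_eqF.
have q0 : (0 < q)%R by rewrite divr_gt0// subr_gt0.
have qV : (1 - q^-1 = p^-1)%R.
  by rewrite /q invf_div -{1}(@divff _ p) ?gt_eqF// -mulrBl opprB addrC subrK div1r.
pose hk (k : nat) w : R := (fine (mine (h w) k%:R%:E) * \1_(E k) w.2)%R.
have mine0 (k : nat) w : 0 <= mine (h w) k%:R%:E.
  by rewrite le_min h0 lee_fin ler0n.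
have mine_fin (k : nat) w : mine (h w) k%:R%:E \is a fin_num.
  by rewrite ge0_fin_numE// gt_min ltry orbT.
have hk0 k w : (0 <= hk k w)%R.
  by rewrite mulr_ge0// fine_ge0.
have hkle k w : (hk k w)%:E <= h w.
  rewrite /hk EFinM fineK// indicE; case: (_ \in _); last by rewrite mule0.
  by rewrite mule1 ge_min lexx.
have mhk k : measurable_fun setT (hk k).
  apply: measurable_funM.
    by apply: measurableT_comp => //; exact: measurable_mine.
  by apply: measurableT_comp => //; apply: measurable_indic; have [] := Eoo k.
pose N k y := \int[nu]_z (hk k (y, z) `^ p)%:E.
have mhp k : measurable_fun setT (fun w => (hk k w `^ p)%:E).
  by apply/measurable_EFinP; apply: (measurableT_comp (measurable_powR _)).
have N0 k y : 0 <= N k y by apply: integral_ge0 => z _; rewrite lee_fin powR_ge0.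
have Nfin k y : N k y \is a fin_num.
  rewrite ge0_fin_numE//; have [mE Ek] := Eoo k.
  apply: (@le_lt_trans _ _ (\int[nu]_z ((k%:R `^ p)%:E * (\1_(E k) z)%:E))).
    apply: ge0_le_integralT => z; first by rewrite lee_fin powR_ge0.
    rewrite -EFinM lee_fin /hk indicE/=; case: (_ \in _).
      rewrite !mulr1; apply: ge0_ler_powR; rewrite ?nnegrE ?ler0n ?(ltW p0)//.
        by rewrite fine_ge0.
      by rewrite -lee_fin fineK// ge_min lexx orbT.
    by rewrite !mulr0 powR0 ?gt_eqF.
  rewrite ge0_integralZl//; last first.
    by apply/measurable_EFinP; exact: measurable_indic.
  by rewrite integral_indic// setIT lte_mul_pinfty// lee_fin powR_ge0.
have mN k : measurable_fun setT (N k).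
  apply: (measurable_fun_fubini_tonelli_F (fun w => (hk k w `^ p)%:E)) => //.
  by move=> w; rewrite lee_fin powR_ge0.
(* [N k y] to the power [1/q] is the norm of [hk] to the power [p-1]. A power of 0 with nonzero
   exponent is 0, so a section with [N k y = 0] receives the zero function. *)
pose c k y := (fine (N k y) `^ (- q^-1))%R.
pose g k w := (hk k w `^ (p - 1) * c k w.1)%R.
have c0 k y : (0 <= c k y)%R by exact: powR_ge0.
have g0 k w : (0 <= g k w)%R by rewrite mulr_ge0// powR_ge0.
exists g; rewrite qE; split => [k|y].
  split => // [|y].
    apply: measurable_funM.
      exact: (measurableT_comp (measurable_powR _)).
    apply: (measurableT_comp (measurable_powR _)).
    by apply: measurableT_comp => //; apply: measurableT_comp.
  rewrite unlock /Lnorm -[leRHS](poweR1r q^-1).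
  apply: le_poweR; first by rewrite invr_ge0 ltW.
    by apply: integral_ge0 => *; exact: poweR_ge0.
  rewrite (_ : \int[nu]_z _ = \int[nu]_z ((hk k (y, z) `^ p)%:E * ((fine (N k y))^-1)%:E)).
    rewrite ge0_integralZr//; last 3 first.
    - exact: (measurableT_comp (mhp k)).
    - by move=> z _; rewrite lee_fin powR_ge0.
    - by rewrite lee_fin invr_ge0 fine_ge0.
    rewrite -/(N k y) -{1}(fineK (Nfin k y)) -EFinM lee_fin.
    by have [->|?] := eqVneq (fine (N k y)) 0%R; rewrite ?mul0r// mulfV.
  apply: eq_integral => z _; rewrite gee0_abs ?lee_fin// poweR_EFin -EFinM.
  congr EFin; rewrite /g powRM ?powR_ge0// -!powRrM /c/=; congr (_ * _)%R.
    by congr powR; rewrite /q mulrCA mulfV ?mulr1// subr_eq0 gt_eqF.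
  by rewrite mulNr mulVf ?gt_eqF// powR_inv1// fine_ge0.
have NI k : N k y `^ p^-1 <= I (g k) y.
  apply: (@le_trans _ _ (\int[nu]_z ((hk k (y, z) `^ p)%:E * (c k y)%:E))); last first.
    apply: ge0_le_integralT => z; first by rewrite mule_ge0// lee_fin ?powR_ge0.
    rewrite -(mulr_powRB1 (hk0 _ _) p0) -EFinM -mulrA EFinM.
    by rewrite lee_wpmul2r// lee_fin// g0.
  rewrite ge0_integralZr//; last 3 first.
  - exact: (measurableT_comp (mhp k)).
  - by move=> z _; rewrite lee_fin powR_ge0.
  - by rewrite lee_fin.
  rewrite -/(N k y) -{1 2}(fineK (Nfin k y)) poweR_EFin -EFinM lee_fin.
  have [->|n0] := eqVneq (fine (N k y)) 0%R.
    by rewrite powR0 ?mul0r// invr_neq0// gt_eqF.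
  rewrite -{2}(powRr1 (fine_ge0 (N0 k y))) /c -powRD ?n0 ?implybT//.
  by rewrite qV.
set S := ereal_sup _.
have IS k : I (g k) y <= S by apply: ereal_sup_ubound; exists k.
have S0 : 0 <= S by apply: le_trans (IS 0%N); apply: le_trans (NI 0%N);
    exact: poweR_ge0.
have NS k : N k y <= S `^ p.
  have /(le_poweR (ltW p0) (poweR_ge0 _ _)) := le_trans (NI k) (IS k).
  by rewrite -poweRrM mulVf ?gt_eqF// poweRe1.
have hkS k m z : (k <= m)%N -> (hk k (y, z) <= hk m (y, z))%R.
  move=> km; apply: ler_pM => //.
  - by rewrite fine_ge0.
  - apply: fine_le => //; rewrite le_min !ge_min lexx/= orbC.
    by rewrite lee_fin ler_nat km.
  - rewrite !indicE ler_nat; case: (boolP (z \in E k)) => //= zE.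
    by rewrite mem_set//; move/set_mem : zE; have /subsetPset := ndE _ _ km; exact.
rewrite unlock /Lnorm -[S]poweRe1// -(@mulfV _ p) ?gt_eqF// poweRrM.
apply: le_poweR; first by rewrite invr_ge0 ltW.
  by apply: integral_ge0 => *; exact: poweR_ge0.
pose L z := limn (fun k => (hk k (y, z) `^ p)%:E).
have ndh z : nondecreasing_seq (fun k => (hk k (y, z) `^ p)%:E).
  move=> k m km; rewrite lee_fin; apply: ge0_ler_powR; rewrite ?nnegrE ?(ltW p0)//.
  exact: hkS.
apply: (@le_trans _ _ (\int[nu]_z L z)); last first.
  rewrite monotone_convergence//; last 2 first.
  - by move=> k; exact: (measurableT_comp (mhp k)).
  - by move=> k z _; rewrite lee_fin powR_ge0.
  apply: lime_le.
    apply: ereal_nondecreasing_is_cvgn => k m km; apply: ge0_le_integralT => z.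
      by rewrite lee_fin powR_ge0.
    exact: ndh.
  by apply: nearW => k; exact: NS.
apply: ge0_le_integralT => z; first exact: poweR_ge0.
have LE : L z = ereal_sup (range (fun k => (hk k (y, z) `^ p)%:E)).
  by apply/cvg_lim => //; exact: ereal_nondecreasing_cvgn.
have hkL k : (hk k (y, z) `^ p)%:E <= L z.
  by rewrite LE; apply: ereal_sup_ubound; exists k.
have L0 : 0 <= L z by apply: le_trans (hkL 0%N); rewrite lee_fin powR_ge0.
suff : h (y, z) <= L z `^ p^-1.
  rewrite gee0_abs// => /(le_poweR (ltW p0) (h0 _)).
  by rewrite -poweRrM mulVf ?gt_eqF// poweRe1.
have hkl k : (hk k (y, z))%:E <= L z `^ p^-1.
  have pV0 : (0 <= p^-1)%R by rewrite invr_ge0 ltW.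
  have hp0 : 0 <= (hk k (y, z) `^ p)%:E by rewrite lee_fin powR_ge0.
  have := le_poweR pV0 hp0 (hkL k).
  by rewrite poweR_EFin -powRrM mulfV ?gt_eqF// powRr1.
case El : (L z `^ p^-1) => [l||]; [|by rewrite leey|]; last first.
  by have := poweR_ge0 (L z) p^-1; rewrite El.
have [k0 _ zk0] : (\bigcup_i E i) z by rewrite -TE.
have [k1 lk1] : exists k1 : nat, (l < k1%:R)%R.
  by exists (Num.truncn l).+1; rewrite truncnS_gt.
(* For this [k] the point [z] lies in [E k] and [l < k], so [min(h, k) <= l] forces [h <= l]. *)
pose k := maxn k0 k1.
have : (hk k (y, z))%:E <= l%:E by rewrite -El.
rewrite /hk EFinM fineK// indicE mem_set ?mule1; last first.
  by move: zk0; have /subsetPset := ndE _ _ (leq_maxl k0 k1); exact.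
rewrite ge_min => /orP[//|]; rewrite lee_fin => kl.
by have := lt_le_trans lk1 (le_trans _ kl); rewrite ler_nat leq_maxr ltxx => /(_ isT).
Qed.

(** Averaging [h] over the part of [E i] where [h > r] gives at least [r] as soon as this part has
    positive measure. With [i] and the rational [r] varying, no level above the supremum [S] of
    these averages can be exceeded on a set of positive measure. *)
Let norming_y : norming +oo.
Proof.
have [E [TE ndE Eoo]] := (sigma_finiteP _ _).1 (sigma_finiteT nu).
(* Enumerates the pairs of an index of the exhaustion and a rational level; an integer that codes no
   pair gives [(0, 0)]. *)
pose dec i : nat * rat := odflt (0%N, 0%R) (unpickle i).
pose A i := [set w : Y * Z | E (dec i).1 w.2 /\ (ratr (dec i).2)%:E < h w].
pose m i y := nu (xsection (A i) y).
have mA i : measurable (A i).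
  rewrite (_ : A i = (snd @^-1` E (dec i).1) `&` [set w | (ratr (dec i).2)%:E < h w])//.
  apply: measurableI; last first.
    by rewrite -[X in measurable X]setTI; exact: emeasurable_fun_o_infty.
  rewrite -[X in measurable X]setTI; apply: measurable_snd => //.
  by have [] := Eoo (dec i).1.
have mfin i y : m i y \is a fin_num.
  rewrite ge0_fin_numE//; have [mE] := Eoo (dec i).1; apply: le_lt_trans.
  by apply: le_measure; rewrite ?inE//;
      [exact: measurable_xsection|move=> z /xsectionP[]].
have mm i : measurable_fun setT (m i) by exact: measurable_fun_xsection.
have intA i y : \int[nu]_z (\1_(A i) (y, z))%:E = m i y.
  by have := congr1 (fun F => F y) (indic_fubini_tonelli_FE nu (mA i)).
pose g i w : R := (\1_(A i) w * (fine (m i w.1))^-1)%R.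
have g0 i w : (0 <= g i w)%R by rewrite mulr_ge0// invr_ge0 fine_ge0.
have mg i : measurable_fun setT (g i).
  apply: measurable_funM; first exact: measurable_indic.
  (* The inverse is measurable as the power of exponent -1; the two agree at 0 also, where both are
     0. *)
  rewrite (_ : (fun w => _) = fun w => fine (m i w.1) `^ (-1))%R; last first.
    by apply/funext => w; rewrite powR_inv1// fine_ge0.
  apply: (measurableT_comp (measurable_powR _)).
  by apply: measurableT_comp => //; apply: measurableT_comp.
have mgy i y : measurable_fun setT (fun z => (g i (y, z))%:E).
  by apply/measurable_EFinP; exact: measurableT_comp.
have intg i y : \int[nu]_z (g i (y, z))%:E = (fine (m i y) * (fine (m i y))^-1)%:E.
  under eq_integral do rewrite /g EFinM /=.
  rewrite ge0_integralZr//; last 2 first.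
  - by apply/measurable_EFinP; apply: measurableT_comp => //; exact: measurable_indic.
  - by rewrite lee_fin invr_ge0 fine_ge0.
  by rewrite intA EFinM fineK.
exists g; rewrite hoelder_conjugatey; split => [i|y].
  split => // y; rewrite Lnorm1.
  under eq_integral do rewrite gee0_abs ?lee_fin//.
  rewrite intg lee_fin; have [->|?] := eqVneq (fine (m i y)) 0%R.
    by rewrite mul0r.
  by rewrite mulfV.
set S := ereal_sup _.
have IS i : I (g i) y <= S by apply: ereal_sup_ubound; exists i.
have I0 i : 0 <= I (g i) y.
  by apply: integral_ge0 => z _; rewrite mule_ge0// lee_fin.
have S0 : 0 <= S by apply: le_trans (IS 0%N).
have mS i : m i y != 0 -> (ratr (dec i).2)%:E <= S.
  move=> mn0; apply: le_trans (IS i).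
  have [l0|l0] := leP (ratr (dec i).2 : R) 0%R.
    by apply: le_trans (I0 i); rewrite lee_fin.
  apply: (@le_trans _ _ (\int[nu]_z ((ratr (dec i).2)%:E * (g i (y, z))%:E))).
    rewrite ge0_integralZl//; last 2 first.
    - by move=> z _; rewrite lee_fin.
    - by rewrite lee_fin ltW.
    by rewrite intg mulfV ?mule1// fine_eq0.
  apply: ge0_le_integralT => z; first by rewrite mule_ge0// lee_fin// ltW.
  rewrite /g indicE; case: (boolP ((y, z) \in A i)) => [/set_mem[_ /ltW lh]|_].
    by rewrite lee_wpmul2r// lee_fin mul1r invr_ge0 fine_ge0.
  by rewrite !mul0r !mule0.
apply: (Lnorm_y_leP _ _ S0).2.
(* Each level set above [S] has a null section by [mS], and there are countably many of them. *)
have aeA : \forall z \ae nu, forall i, S < (ratr (dec i).2)%:E -> ~ A i (y, z).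
  apply/ae_foralln => i; have [lS|Sl] := leP (ratr (dec i).2)%:E S.
    exact: nearW.
  have mi0 : m i y = 0.
    by apply/eqP; apply: contraPT Sl => /mS; rewrite leNgt => /negP.
  exists (xsection (A i) y); split => //; first exact: measurable_xsection.
  move=> z /= nz; apply/xsectionP; apply: contrapT => nA; exact: nz.
apply: filterS aeA => z Az; rewrite gee0_abs// leNgt; apply/negP => Sh.
have [k _ zk] : (\bigcup_i E i) z by rewrite -TE.
have [r Sr rh] : exists2 r : rat, S < (ratr r)%:E & (ratr r)%:E < h (y, z).
  move: Sh S0; case: (S) => [s||]; last 2 first.
  - by rewrite ltNge leey.
  - by [].
  case: (h (y, z)) => [t||//].
    rewrite lte_fin => st _; have [r] := rat_in_itvoo st.
    by rewrite in_itv/= => /andP[sr rt]; exists r; rewrite lte_fin.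
  have /rat_in_itvoo[r] : (s < s + 1)%R by rewrite ltrDl.
  by rewrite in_itv/= => /andP[sr rt]; exists r; rewrite ?lte_fin ?ltry.
have := Az (pickle (k, r)); rewrite /A /dec pickleK/=.
by move=> /(_ Sr); apply; split.
Qed.

Lemma Lnorm_norming p : 1 <= p -> exists G : nat -> Y * Z -> R,
  [/\ forall k, unit_section (hoelder_conjugate p) (G k),
      forall y, nondecreasing_seq
        (fun k => \int[nu]_z (h (y, z) * (G k (y, z))%:E)) &
      forall y, Lnorm nu p (fun z => h (y, z)) <=
        ereal_sup (range (fun k => \int[nu]_z (h (y, z) * (G k (y, z))%:E)))].
Proof.
move=> p1; suff [g [ug gN]] : norming p.
  have [G [uG ndG gG]] := unit_section_nondecreasing ug.
  exists G; split; [exact: uG|exact: ndG|move=> y; apply: le_trans (gN y) _].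
  apply: ge_ereal_sup => _ [k _ <-]; apply: le_trans (gG k y) _.
  by apply: ereal_sup_ubound; exists k.
case: p p1 => [p||//] p1; last exact: norming_y.
have [->|pn1] := eqVneq p 1%R; first exact: norming1.
by apply: norming_fin; rewrite lt_neqAle eq_sym pn1.
Qed.

End norming.

Section duality.
Context (R : realType).

(** Peels off one inner norm; the weight [c] carries the functions already chosen for the outer
    variables. The norming sequence is nondecreasing in order that monotone convergence take its
    supremum out of the integral over [y]. *)
Lemma Lnorm_dual_section d1 d2 (Y : measurableType d1) (Z : measurableType d2)
    (mu : {measure set Y -> \bar R}) (nu : {sigma_finite_measure set Z -> \bar R})
    p (h : Y * Z -> \bar R) (c : Y -> R) (K : \bar R) : 1 <= p ->
  measurable_fun setT h -> (forall w, 0 <= h w) ->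
  measurable_fun setT c -> (forall y, 0 <= c y)%R ->
  (forall g, unit_section nu (hoelder_conjugate p) g ->
    \int[mu]_y \int[nu]_z (h (y, z) * (c y * g (y, z))%:E) <= K) ->
  \int[mu]_y ((c y)%:E * Lnorm nu p (fun z => h (y, z))) <= K.
Proof.
move=> p1 mh h0 mc c0 hK.
have [G [uG ndG NG]] := Lnorm_norming nu mh h0 p1.
pose J k y := (c y)%:E * \int[nu]_z (h (y, z) * (G k (y, z))%:E).
have hG0 k y z : 0 <= h (y, z) * (G k (y, z))%:E.
  by rewrite mule_ge0// lee_fin; have [_ ->] := uG k.
have I0 k y : 0 <= \int[nu]_z (h (y, z) * (G k (y, z))%:E).
  by apply: integral_ge0 => z _.
have mhG k : measurable_fun setT (fun w => h w * (G k w)%:E).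
  by apply: emeasurable_funM => //; apply/measurable_EFinP; have [] := uG k.
have mJ k : measurable_fun setT (J k).
  apply: emeasurable_funM; first exact/measurable_EFinP.
  by apply: (measurable_fun_fubini_tonelli_F (fun w => h w * (G k w)%:E)) => // -[].
have J0 k y : 0 <= J k y by rewrite mule_ge0// lee_fin.
have ndJ y : nondecreasing_seq (J ^~ y).
  by move=> k l kl; rewrite lee_wpmul2l ?lee_fin//; exact: ndG.
apply: (@le_trans _ _ (\int[mu]_y limn (J ^~ y))).
  apply: ge0_le_integralT => y; first by rewrite mule_ge0 ?lee_fin ?Lnorm_ge0.
  rewrite (cvg_lim _ (ereal_nondecreasing_cvgn (ndJ y)))//.
  rewrite (_ : range (J ^~ y) = (mule (c y)%:E) @` (range
      (fun k => \int[nu]_z (h (y, z) * (G k (y, z))%:E)))).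
    rewrite ereal_supZl//; last first.
      by apply/set0P; exists (\int[nu]_z (h (y, z) * (G 0%N (y, z))%:E)); exists 0%N.
    by rewrite lee_wpmul2l// lee_fin.
  by rewrite image_comp.
rewrite monotone_convergence//; apply: lime_le.
  apply: ereal_nondecreasing_is_cvgn => k l kl.
  by apply: ge0_le_integralT => y //; exact: ndJ.
apply: nearW => k; apply: le_trans (hK _ (uG k)).
apply: ge0_le_integralT => y //; rewrite /J -ge0_integralZl//.
- apply: ge0_le_integralT => z; first by rewrite mule_ge0 ?lee_fin.
  by rewrite EFinM muleCA.
- by apply: (measurableT_comp (mhG k)).
- by rewrite lee_fin.
Qed.

(** Here the parameter space is reduced to a point. *)
Lemma Lnorm_dual d (Z : measurableType d)
    (nu : {sigma_finite_measure set Z -> \bar R}) p (h : Z -> \bar R)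
    (K : \bar R) : 1 <= p ->
  measurable_fun setT h -> (forall z, 0 <= h z) ->
  (forall g : Z -> R, measurable_fun setT g -> (forall z, 0 <= g z)%R ->
    Lnorm nu (hoelder_conjugate p) (EFin \o g) <= 1 ->
    \int[nu]_z (h z * (g z)%:E) <= K) ->
  Lnorm nu p h <= K.
Proof.
move=> p1 mh h0 hK.
have [G [uG _ NG]] := @Lnorm_norming _ _ unit Z R nu (fun w => h w.2)
  (measurableT_comp mh measurable_snd) (fun w => h0 w.2) p p1.
apply: le_trans (NG tt) _; apply: ge_ereal_sup => _ [k _ <-].
have [mG G0 G1] := uG k; apply: hK => //; last exact: (G1 tt).
exact: (measurableT_comp mG (pair1_measurable tt)).
Qed.

End duality.

Section mixed_norm_duality.
Context (R : realType) (n : nat).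
Local Notation X := (Rn R n * Rn R n)%type.
Local Notation TR := (measurableTypeR R).
Local Notation leb := (@lebesgue_measure R).
Local Notation m := (lebesgue_Rn R n).
Local Notation mx := (m \x m).

Lemma measurable_norm_xv d (Y : measurableType d) r p (F : Y * X -> \bar R) :
  1 <= r -> 1 <= p -> measurable_fun setT F ->
  measurable_fun setT (fun y => norm_xv r p (fun z => F (y, z))).
Proof.
move=> r1 p1 mF; rewrite /norm_xv.
apply: (measurable_Lnorm _ (h := fun w : Y * Rn R n =>
  Lnorm m p (fun v => F (w.1, (w.2, v))))) => //.
apply: (measurable_Lnorm _ (h := fun w : Y * Rn R n * Rn R n =>
  F (w.1.1, (w.1.2, w.2)))) => //.
apply: (measurableT_comp mF); apply/measurable_fun_pairP; split => /=.
  exact: (measurableT_comp measurable_fst measurable_fst).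
apply/measurable_fun_pairP; split => /=; last exact: measurable_snd.
exact: (measurableT_comp measurable_snd measurable_fst).
Qed.

Lemma norm_xv_ge0 b c (f : X -> \bar R) : 0 <= norm_xv b c f.
Proof. exact: Lnorm_ge0. Qed.

Lemma norm_txv_ge0 q r p (F : R -> X -> \bar R) : 0 <= norm_txv q r p F.
Proof. exact: Lnorm_ge0. Qed.

Lemma le_norm_xv b c (f g : X -> \bar R) : 1 <= b -> 1 <= c ->
  (forall z, `|f z| <= `|g z|) -> norm_xv b c f <= norm_xv b c g.
Proof.
move=> b1 c1 fg; apply: le_Lnorm => // x.
by rewrite !gee0_abs ?Lnorm_ge0//; apply: le_Lnorm.
Qed.

Lemma le_norm_txv q r p (F G : R -> X -> \bar R) : 1 <= q -> 1 <= r -> 1 <= p ->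
  (forall t z, `|F t z| <= `|G t z|) -> norm_txv q r p F <= norm_txv q r p G.
Proof.
move=> q1 r1 p1 FG; apply: le_Lnorm => // t.
by rewrite !gee0_abs ?norm_xv_ge0//; apply: le_norm_xv.
Qed.

Lemma norm_xv_hoelder b c (f g : X -> \bar R) : 1 <= b -> 1 <= c ->
  measurable_fun setT f -> measurable_fun setT g ->
  (forall z, 0 <= f z) -> (forall z, 0 <= g z) ->
  \int[mx]_z (f z * g z) <=
    norm_xv b c f * norm_xv (hoelder_conjugate b) (hoelder_conjugate c) g.
Proof.
move=> b1 c1 mf mg f0 g0.
have mN c' (f' : X -> \bar R) : 1 <= c' -> measurable_fun setT f' ->
    measurable_fun setT (fun x => Lnorm m c' (fun v => f' (x, v))).
  by move=> c'1 mf'; exact: measurable_Lnorm.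
have c'1 := hoelder_conj_ge1 c1.
rewrite fubini_tonelli1//; last 2 first.
- exact: emeasurable_funM.
- by move=> z; rewrite mule_ge0.
apply: le_trans (ge0_hoelder _ b1 (mN _ _ c1 mf) (mN _ _ c'1 mg) _ _) => //.
- apply: ge0_le_integralT => x; first by apply: integral_ge0 => v _; rewrite mule_ge0.
  by apply: ge0_hoelder => //; exact: measurableT_comp.
- by move=> x; exact: Lnorm_ge0.
- by move=> x; exact: Lnorm_ge0.
Qed.

Lemma norm_txv_hoelder q r p (F G : R -> X -> \bar R) :
  1 <= q -> 1 <= r -> 1 <= p ->
  measurable_fun [set: TR * X] (uncurry F) ->
  measurable_fun [set: TR * X] (uncurry G) ->
  (forall t z, 0 <= F t z) -> (forall t z, 0 <= G t z) ->
  \int[leb]_t \int[mx]_z (F t z * G t z) <=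
    norm_txv q r p F * norm_txv (hoelder_conjugate q) (hoelder_conjugate r)
      (hoelder_conjugate p) G.
Proof.
move=> q1 r1 p1 mF mG F0 G0.
have r'1 := hoelder_conj_ge1 r1; have p'1 := hoelder_conj_ge1 p1.
apply: le_trans (ge0_hoelder _ q1 _ _ _ _).
- apply: ge0_le_integralT => t; first by apply: integral_ge0 => z _; rewrite mule_ge0.
  apply: norm_xv_hoelder => //.
    exact: (measurableT_comp mF (pair1_measurable t)).
  exact: (measurableT_comp mG (pair1_measurable t)).
- exact: (measurable_norm_xv r1 p1 mF).
- exact: (measurable_norm_xv r'1 p'1 mG).
- by move=> t; exact: norm_xv_ge0.
- by move=> t; exact: norm_xv_ge0.
Qed.

(** The test function is built as [g1(t) g2(t,x) g3(t,x,v)], one factor for each norm from the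
    outside in. Each factor lies in the unit ball of its last variable for all values of the others,
    so the mixed dual norm of the product is at most that of [g1]. *)
Lemma norm_txv_dual q r p (F : R -> X -> \bar R) (K : \bar R) :
  1 <= q -> 1 <= r -> 1 <= p ->
  measurable_fun [set: TR * X] (uncurry F) -> (forall t z, 0 <= F t z) ->
  (forall G : R -> X -> R, measurable_fun [set: TR * X] (uncurry G) ->
    (forall t z, 0 <= G t z)%R ->
    norm_txv (hoelder_conjugate q) (hoelder_conjugate r)
      (hoelder_conjugate p) (fun t => EFin \o G t) <= 1 ->
    \int[leb]_t \int[mx]_z (F t z * (G t z)%:E) <= K) ->
  norm_txv q r p F <= K.
Proof.
move=> q1 r1 p1 mF F0 FK.
have q'1 := hoelder_conj_ge1 q1.
have r'1 := hoelder_conj_ge1 r1; have p'1 := hoelder_conj_ge1 p1.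
pose P := fun w : TR * Rn R n => Lnorm m p (fun v => F w.1 (w.2, v)).
pose F3 := fun w : TR * Rn R n * Rn R n => F w.1.1 (w.1.2, w.2).
have mF3 : measurable_fun setT F3.
  apply: (measurableT_comp mF
      (g := fun w : TR * Rn R n * Rn R n => (w.1.1, (w.1.2, w.2)))).
  apply/measurable_fun_pairP; split => /=.
    exact: (measurableT_comp measurable_fst measurable_fst).
  apply/measurable_fun_pairP; split => /=; last exact: measurable_snd.
  exact: (measurableT_comp measurable_snd measurable_fst).
have mP : measurable_fun setT P by exact: measurable_Lnorm mF3.
have P0 w : 0 <= P w by exact: Lnorm_ge0.
apply: Lnorm_dual => //; first exact: (measurable_norm_xv r1 p1 mF).
  by move=> t; exact: norm_xv_ge0.
move=> g1 mg1 g10 Ng1; under eq_integral do rewrite muleC.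
apply: (Lnorm_dual_section (h := P)) => // g2 [mg2 g20 Ng2].
pose c2 w := (g1 w.1 * g2 w)%R.
have mc2 : measurable_fun setT c2.
  by apply: measurable_funM => //; apply: (measurableT_comp mg1).
have c20 w : (0 <= c2 w)%R by rewrite mulr_ge0.
rewrite (_ : \int[leb]_y _ = \int[leb \x m]_w ((c2 w)%:E * P w)); last first.
  rewrite (fubini_tonelli1 (m1 := leb) (m2 := m) (fun w => (c2 w)%:E * P w)).
  - by apply: eq_integral => t _; apply: eq_integral => x _; rewrite muleC.
  - by apply: emeasurable_funM => //; exact/measurable_EFinP.
  - by move=> w; rewrite mule_ge0// lee_fin.
apply: (Lnorm_dual_section (h := F3)) => // [[[t x] v]|g3 [mg3 g30 Ng3]].
  exact: F0.
pose G t (z : X) := (c2 (t, z.1) * g3 ((t, z.1), z.2))%R.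
have mG3 : measurable_fun setT (fun w => c2 w.1 * g3 w)%R.
  by apply: measurable_funM => //; apply: (measurableT_comp mc2).
have mG : measurable_fun [set: TR * X] (uncurry G).
  rewrite (_ : uncurry G = (fun w => c2 w.1 * g3 w)%R \o
    (fun w : TR * X => ((w.1, w.2.1), w.2.2))); last by apply/funext => -[].
  apply: (measurableT_comp mG3); apply/measurable_fun_pairP; split => /=.
    apply/measurable_fun_pairP; split => /=; first exact: measurable_fst.
    exact: (measurableT_comp measurable_fst measurable_snd).
  exact: (measurableT_comp measurable_snd measurable_snd).
have G0 t z : (0 <= G t z)%R by rewrite mulr_ge0.
have mFG : measurable_fun setT
    (fun w : TR * Rn R n * Rn R n => F3 w * (c2 w.1 * g3 w)%:E).
  by apply: emeasurable_funM => //; exact/measurable_EFinP.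
have FG0 (w : TR * Rn R n * Rn R n) : 0 <= F3 w * (c2 w.1 * g3 w)%:E.
  by rewrite mule_ge0 ?lee_fin ?mulr_ge0//; case: w => -[t x] v; exact: F0.
rewrite (_ : \int[leb \x m]_w _ = \int[leb]_t \int[mx]_z (F t z * (G t z)%:E)).
  apply: FK => //; apply: le_trans Ng1; apply: le_Lnorm => // t.
  rewrite gee0_abs ?norm_xv_ge0// gee0_abs ?lee_fin//.
  rewrite -[leRHS]mule1; apply: (le_trans _ (lee_wpmul2l _ (Ng2 t))); last first.
    by rewrite lee_fin.
  rewrite -ge0_LnormZ//; last by apply/measurable_EFinP; apply: measurableT_comp.
  apply: le_Lnorm => // x.
  rewrite gee0_abs ?Lnorm_ge0// gee0_abs ?mule_ge0 ?lee_fin//.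
  rewrite -EFinM -[leRHS]mule1; apply: (le_trans _ (lee_wpmul2l
      _ (Ng3 (t, x)))); last first.
    by rewrite lee_fin mulr_ge0.
  rewrite -ge0_LnormZ ?mulr_ge0//; last by apply/measurable_EFinP;
      apply: measurableT_comp.
rewrite (fubini_tonelli1 (m1 := leb) (m2 := m)
    (fun w => \int[m]_z (F3 (w, z) * (c2 w * g3 (w, z))%:E))).
- apply: eq_integral => t _.
  rewrite (fubini_tonelli1 (m1 := m) (m2 := m) (fun z => F t z * (G t z)%:E)).
  + by [].
  + apply: emeasurable_funM; first exact: (measurableT_comp mF (pair1_measurable t)).
    by apply/measurable_EFinP; exact: (measurableT_comp mG (pair1_measurable t)).
  + by move=> z; rewrite mule_ge0 ?lee_fin.
- exact: (measurable_fun_fubini_tonelli_F _ mFG).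
- by move=> w; apply: integral_ge0 => z _; exact: (FG0 (w, z)).
Qed.

End mixed_norm_duality.

(** * Invariance of Lebesgue measure *)

Section measure_preserving_maps.
Context (R : realType).
Local Notation TR := (measurableTypeR R).
Local Notation leb := (@lebesgue_measure R).

Lemma measure_preserving_comp d (T : measurableType d)
    (mu : {measure set T -> \bar R}) (f g : T -> T) :
  measure_preserving mu f -> measure_preserving mu g ->
  measure_preserving mu (f \o g).
Proof.
move=> [mf fE] [mg gE]; split; first exact: measurableT_comp.
move=> A mA; rewrite comp_preimage gE ?fE//.
by rewrite -[X in measurable X]setTI; exact: mf.
Qed.

Lemma measure_preserving_opp : measure_preserving leb (fun t : TR => - t)%R.
Proof.
split; first exact: oppr_measurable.
by move=> A mA; exact: lebesgue_measureN.
Qed.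

(** By uniqueness of Lebesgue measure, it suffices that the pushforward gives half-open intervals
    their length. *)
Lemma measure_preserving_shift (a : R) :
  measure_preserving leb (fun t : TR => t + a)%R.
Proof.
have ms : measurable_fun setT ((fun t => (t + a)%R) : TR -> TR).
  by apply: measurable_funD => //; exact: measurable_cst.
split => // A mA; apply/esym.
pose ms' := isMeasurableFun.Build _ _ _ _ _ ms.
pose s : {mfun TR >-> TR} := HB.pack ((fun t => (t + a)%R) : TR -> TR) ms'.
apply: (lebesgue_measure_unique (mu := pushforward leb s)) => //= _ [[b c]] _ <-.
rewrite /pushforward.
rewrite (_ : _ @^-1` _ = `](b - a)%R, (c - a)%R]%classic); last first.
  by apply/seteqP; split => t /=; rewrite !in_itv/= ltrBlDr lerBrDr.
rewrite /= !lebesgue_measure_itv/= !lte_fin ltrBlDr subrK.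
by case: ifPn => // _; rewrite -!EFinB opprB addrA subrK.
Qed.

Section shear.
Context d1 d2 (T1 : measurableType d1) (T2 : measurableType d2).
Variable mu1 : {sigma_finite_measure set T1 -> \bar R}.
Variable mu2 : {sigma_finite_measure set T2 -> \bar R}.

Let integral_indicE d (T : measurableType d) (mu : {measure set T -> \bar R})
    (A : set T) : measurable A -> mu A = \int[mu]_x (\1_A x)%:E.
Proof. by move=> mA; rewrite integral_indic// setIT. Qed.

Let measurable_indicE (B : set (T1 * T2)) : measurable B ->
  measurable_fun setT (fun w : T1 * T2 => (\1_B w)%:E : \bar R).
Proof. by move=> mB; apply/measurable_EFinP; exact: measurable_indic. Qed.

Let indic_ge0 (B : set (T1 * T2)) w : 0 <= (\1_B w)%:E :> \bar R.
Proof. by rewrite lee_fin. Qed.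

(** Tonelli with the moved variable innermost: for each value of the fixed variable, the inner
    integral is unchanged. *)
Lemma measure_preserving_shearl (phi : T2 -> T1 -> T1) :
  measurable_fun setT (fun w : T1 * T2 => (phi w.2 w.1, w.2)) ->
  (forall y, measure_preserving mu1 (phi y)) ->
  measure_preserving (mu1 \x mu2) (fun w => (phi w.2 w.1, w.2)).
Proof.
move=> mphi phiE; split => // A mA.
have E B : measurable B ->
    (mu1 \x mu2) B = \int[mu2]_y \int[mu1]_x (\1_B (x, y))%:E.
  move=> mB; rewrite integral_indicE//.
  exact: (fubini_tonelli2 _ (measurable_indicE mB) (indic_ge0 B)).
have mA' : measurable ((fun w : T1 * T2 => (phi w.2 w.1, w.2)) @^-1` A).
  by rewrite -[X in measurable X]setTI; exact: mphi.
apply: (etrans (E _ mA')); apply: (etrans _ (esym (E _ mA))).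
apply: eq_integral => y _.
apply: (measure_preserving_integral (phiE y) (f := fun x => (\1_A (x, y))%:E)).
  exact: (measurableT_comp (measurable_indicE mA) (pair2_measurable y)).
by move=> x; exact: (indic_ge0 A (x, y)).
Qed.

Lemma measure_preserving_shearr (psi : T1 -> T2 -> T2) :
  measurable_fun setT (fun w : T1 * T2 => (w.1, psi w.1 w.2)) ->
  (forall x, measure_preserving mu2 (psi x)) ->
  measure_preserving (mu1 \x mu2) (fun w => (w.1, psi w.1 w.2)).
Proof.
move=> mpsi psiE; split => // A mA.
have E B : measurable B ->
    (mu1 \x mu2) B = \int[mu1]_x \int[mu2]_y (\1_B (x, y))%:E.
  move=> mB; rewrite integral_indicE//.
  exact: (fubini_tonelli1 _ (measurable_indicE mB) (indic_ge0 B)).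
have mA' : measurable ((fun w : T1 * T2 => (w.1, psi w.1 w.2)) @^-1` A).
  by rewrite -[X in measurable X]setTI; exact: mpsi.
apply: (etrans (E _ mA')); apply: (etrans _ (esym (E _ mA))).
apply: eq_integral => x _.
apply: (measure_preserving_integral (psiE x) (f := fun y => (\1_A (x, y))%:E)).
  exact: (measurableT_comp (measurable_indicE mA) (pair1_measurable x)).
by move=> y; exact: (indic_ge0 A (x, y)).
Qed.

End shear.

(** Serves both for translations of [x] by a vector and for the sign change of [v]. *)
Definition map_coord n (phi : 'I_n -> TR -> TR) (x : Rn R n) : Rn R n :=
  [tuple phi i (tnth x i) | i < n].

Lemma measurable_map_coord n (phi : 'I_n -> TR -> TR) :
  (forall i, measurable_fun setT (phi i)) -> measurable_fun setT (map_coord phi).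
Proof.
move=> mphi; apply/measurable_fun_tnthP => i.
rewrite (_ : _ \o _ = phi i \o (fun x : Rn R n => tnth x i)).
  by apply: measurableT_comp => //; exact: measurable_tnth.
by apply/funext => x /=; rewrite tnth_mktuple.
Qed.

(** Induction on [n]: through [cons_pair], the map acts on the first coordinate and on the remaining
    ones separately, hence is a composite of two shears of the product. *)
Lemma measure_preserving_map_coord n (phi : 'I_n -> TR -> TR) :
  (forall i, measure_preserving leb (phi i)) ->
  measure_preserving (lebesgue_Rn R n) (map_coord phi).
Proof.
elim: n phi => [|n ih] phi phiE.
  split; first by apply: measurable_map_coord => -[].
  move=> A mA; congr (lebesgue_Rn R 0 _); apply/seteqP.
  by split => x /=; rewrite (tuple0 (map_coord phi x)) (tuple0 x).
have mphi i : measurable_fun setT (phi i) by have [] := phiE i.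
split; first exact: measurable_map_coord.
move=> A mA; rewrite /= /lebesgue_step /pushforward.
pose psi (i : 'I_n) := phi (lift ord0 i).
have [mphi0 phi0E] := phiE ord0.
have [mpsi psiE] : measure_preserving (lebesgue_Rn R n) (map_coord psi).
  by apply: ih => i; exact: phiE.
pose B := cons_pair @^-1` A.
have mB : measurable B.
  by rewrite -[X in measurable X]setTI; exact: measurable_cons_pair.
pose F1 := fun w : TR * Rn R n => (phi ord0 w.1, w.2).
pose F2 := fun w : TR * Rn R n => (w.1, map_coord psi w.2).
have mF1 : measure_preserving (leb \x lebesgue_Rn R n) F1.
  apply: (@measure_preserving_shearl _ _ _ _ _ _ (fun _ => phi ord0)) => //.
  apply/measurable_fun_pairP; split => /=; last exact: measurable_snd.
  exact: (measurableT_comp mphi0 measurable_fst).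
have mF2 : measure_preserving (leb \x lebesgue_Rn R n) F2.
  apply: (@measure_preserving_shearr _ _ _ _ _ _ (fun _ => map_coord psi)) => //.
  apply/measurable_fun_pairP; split => /=; first exact: measurable_fst.
  exact: (measurableT_comp mpsi measurable_snd).
have [_ FE] := measure_preserving_comp mF1 mF2.
rewrite -/B -(FE _ mB); congr (_ _); apply/seteqP.
have E w : map_coord phi (cons_pair w) = cons_pair (F1 (F2 w)).
  apply: eq_from_tnth => i; rewrite tnth_mktuple.
  by case: (unliftP ord0 i) => [j|] ->; rewrite /cons_pair ?tnthS ?tnth_mktuple.
by split => w /=; rewrite /B /= E.
Qed.

End measure_preserving_maps.

(** * Transport and its bilinear forms *)

Section product_sigma_finite.
Context d1 d2 (T1 : measurableType d1) (T2 : measurableType d2) (R : realType).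
Variable m1 : {sigma_finite_measure set T1 -> \bar R}.
Variable m2 : {sigma_finite_measure set T2 -> \bar R}.

Let product_measure1_sigma_finite : sigma_finite setT (m1 \x m2).
Proof.
have /sigma_finiteP[F [TF ndF Foo]] := sigma_finiteT m1.
have /sigma_finiteP[G [TG ndG Goo]] := sigma_finiteT m2.
exists (fun k => F k `*` G k); last first.
  move=> k; have [mF Fk] := Foo k; have [mG Gk] := Goo k.
  split; first exact: measurableX.
  by rewrite product_measure1E// lte_mul_pinfty// ge0_fin_numE.
apply/seteqP; split => // -[x y] _.
have [i _ Fix] : (\bigcup_k F k) x by rewrite -TF.
have [j _ Gjy] : (\bigcup_k G k) y by rewrite -TG.
exists (maxn i j) => //; split => /=.
  by move: Fix; have /subsetPset := ndF _ _ (leq_maxl i j); exact.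
by move: Gjy; have /subsetPset := ndG _ _ (leq_maxr i j); exact.
Qed.

(* The library's canonical sigma-finite structure on [m1 \x m2] is found only
   when [m1] and [m2] are subprobabilities. *)
Definition sigma_finite_product : {sigma_finite_measure set (T1 * T2)%type -> \bar R} :=
  HB.pack (m1 \x m2)
    (Measure_isSigmaFinite.Build _ _ _ (m1 \x m2) product_measure1_sigma_finite).

End product_sigma_finite.

Section transport_form.
Context (R : realType) (n : nat).
Local Notation X := (Rn R n * Rn R n)%type.
Local Notation TR := (measurableTypeR R).
Local Notation leb := (@lebesgue_measure R).
Local Notation m := (lebesgue_Rn R n).
Local Notation mx := (m \x m).

(* [U t f z] is convertible to [f (shear t z)]. *)
Definition shear (t : R) (z : X) : X :=
  ([tuple (tnth z.1 i : R) - t * (tnth z.2 i : R) | i < n], z.2)%R.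

Lemma shearD s t z : shear s (shear t z) = shear (s + t)%R z.
Proof.
congr pair; apply: eq_from_tnth => i.
by rewrite !tnth_mktuple mulrDl opprD addrAC addrA.
Qed.

Lemma shear0 z : shear 0%R z = z.
Proof.
case: z => x v; congr pair; apply: eq_from_tnth => i.
by rewrite !tnth_mktuple mul0r subr0.
Qed.

Lemma measurable_shear : measurable_fun [set: TR * X] (fun w => shear w.1 w.2).
Proof.
apply/measurable_fun_pairP; split => /=; last first.
  exact: (measurableT_comp measurable_snd measurable_snd).
apply/measurable_fun_tnthP => i.
rewrite (_ : _ \o _ = fun w : TR * X =>
    (tnth w.2.1 i - w.1 * tnth w.2.2 i)%R); last first.
  by apply/funext => w /=; rewrite tnth_mktuple.
have mi := @measurable_tnth _ TR n i.
apply: measurable_funB.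
  exact: (measurableT_comp mi (measurableT_comp measurable_fst measurable_snd)).
apply: measurable_funM; first exact: measurable_fst.
exact: (measurableT_comp mi (measurableT_comp measurable_snd measurable_snd)).
Qed.

(** For fixed [v] the map translates [x] by [- t v]. *)
Lemma measure_preserving_shear t : measure_preserving mx (shear t).
Proof.
apply: (@measure_preserving_shearl _ _ _ _ _ m m
  (fun v x => map_coord (fun i y => y - t * (tnth v i : R))%R x)).
  exact: (measurableT_comp measurable_shear (pair1_measurable t)).
move=> v; apply: measure_preserving_map_coord => i.
exact: (measure_preserving_shift (- (t * tnth v i))%R).
Qed.

Definition reflect_v (z : X) : X := (z.1, map_coord (fun _ y => - y)%R z.2).

Lemma reflect_v_shear t z : reflect_v (shear t z) = shear (- t)%R (reflect_v z).
Proof.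
congr pair; apply: eq_from_tnth => i.
by rewrite !tnth_mktuple mulrNN.
Qed.

Lemma measurable_opp_coord : measurable_fun setT (map_coord (n := n)
    (fun _ (y : TR) => - y)%R).
Proof. by apply: measurable_map_coord => i; exact: oppr_measurable. Qed.

Lemma measure_preserving_opp_coord :
  measure_preserving m (map_coord (n := n) (fun _ (y : TR) => - y)%R).
Proof. by apply: measure_preserving_map_coord => i; exact: measure_preserving_opp. Qed.

Lemma measure_preserving_reflect_v : measure_preserving mx reflect_v.
Proof.
apply: (@measure_preserving_shearr _ _ _ _ _ m m
  (fun x v => map_coord (fun _ y => - y)%R v)) => [|_].
  apply/measurable_fun_pairP; split => /=; first exact: measurable_fst.
  exact: (measurableT_comp measurable_opp_coord measurable_snd).
exact: measure_preserving_opp_coord.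
Qed.

(** The adjoint of [U(t)] is [U(-t)]: a change of variables along [shear t], which preserves the
    measure and has inverse [shear (- t)]. *)
Lemma integral_shear_adjoint t (f g : X -> \bar R) :
  measurable_fun setT f -> measurable_fun setT g ->
  (forall z, 0 <= f z) -> (forall z, 0 <= g z) ->
  \int[mx]_z (f (shear t z) * g z) = \int[mx]_z (f z * g (shear (- t)%R z)).
Proof.
move=> mf mg f0 g0.
have mt := measure_preserving_shear t.
have := measure_preserving_integral mt (f := fun z => f z * g (shear (- t)%R z)).
move=> <-.
- by apply: eq_integral => z _; rewrite shearD addNr shear0.
- apply: emeasurable_funM => //; apply: (measurableT_comp mg).
  by have [] := measure_preserving_shear (- t)%R.
- by move=> z; rewrite mule_ge0.
Qed.

Implicit Types F G : R -> X -> R.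

Definition nonneg_mfun F :=
  measurable_fun [set: TR * X] (uncurry F) /\ forall t z, (0 <= F t z)%R.

Lemma nonneg_mfun_section F t : nonneg_mfun F ->
  measurable_fun setT (fun z => (F t z)%:E).
Proof.
by move=> [mF _]; apply/measurable_EFinP; exact: (measurableT_comp mF
    (pair1_measurable t)).
Qed.

(** This is [B(s,t)] of the overview. *)
Definition pairing F G (s t : R) : \bar R :=
  \int[mx]_z ((F s (shear (t - s)%R z))%:E * (G t z)%:E).

Definition causal_form F G :=
  \int[leb]_t \int[leb]_s (if (s <= t)%R then pairing F G s t else 0).

Definition full_form F G := \int[leb]_t \int[leb]_s pairing F G s t.

Lemma measurable_transport F : nonneg_mfun F ->
  measurable_fun [set: TR * TR * X]
    (fun w => (F w.1.1 (shear (w.1.2 - w.1.1)%R w.2))%:E).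
Proof.
move=> [mF _]; apply/measurable_EFinP.
apply: (measurableT_comp mF
    (g := fun w : TR * TR * X => (w.1.1, shear (w.1.2 - w.1.1)%R w.2))).
apply/measurable_fun_pairP; split => /=.
  exact: (measurableT_comp measurable_fst measurable_fst).
apply: (measurableT_comp measurable_shear
    (g := fun w : TR * TR * X => ((w.1.2 - w.1.1)%R, w.2))).
apply/measurable_fun_pairP; split => /=; last exact: measurable_snd.
apply: measurable_funB.
  exact: (measurableT_comp measurable_snd measurable_fst).
exact: (measurableT_comp measurable_fst measurable_fst).
Qed.

Lemma measurable_pairing_integrand F G : nonneg_mfun F -> nonneg_mfun G ->
  measurable_fun [set: TR * TR * X]
    (fun w => (F w.1.1 (shear (w.1.2 - w.1.1)%R w.2))%:E * (G w.1.2 w.2)%:E).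
Proof.
move=> hF [mG _]; apply: emeasurable_funM; first exact: measurable_transport.
apply/measurable_EFinP.
apply: (measurableT_comp mG (g := fun w : TR * TR * X => (w.1.2, w.2))).
apply/measurable_fun_pairP; split => /=; last exact: measurable_snd.
exact: (measurableT_comp measurable_snd measurable_fst).
Qed.

Lemma measurable_pairing F G : nonneg_mfun F -> nonneg_mfun G ->
  measurable_fun [set: TR * TR] (fun w => pairing F G w.1 w.2).
Proof.
move=> hF hG.
have h := measurable_fun_fubini_tonelli_F (m2 := sigma_finite_product m m)
    _ (measurable_pairing_integrand hF hG).
apply: h => w; apply: mule_ge0; rewrite lee_fin; [exact: hF.2|exact: hG.2].
Qed.

Lemma pairing_ge0 F G s t : nonneg_mfun F -> nonneg_mfun G -> 0 <= pairing F G s t.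
Proof.
move=> hF hG; apply: integral_ge0 => z _.
by rewrite mule_ge0 ?lee_fin; [|exact: hF.2|exact: hG.2].
Qed.

Lemma pairingC F G s t : nonneg_mfun F -> nonneg_mfun G ->
  pairing F G s t = pairing G F t s.
Proof.
move=> hF hG; rewrite /pairing.
rewrite (integral_shear_adjoint (t - s)%R
    (f := fun z => (F s z)%:E) (g := fun z => (G t z)%:E)).
- by apply: eq_integral => z _; rewrite opprB muleC.
- exact: nonneg_mfun_section.
- exact: nonneg_mfun_section.
- by move=> z; rewrite lee_fin; exact: hF.2.
- by move=> z; rewrite lee_fin; exact: hG.2.
Qed.

Lemma measurable_causal_pairing F G : nonneg_mfun F -> nonneg_mfun G ->
  measurable_fun [set: TR * TR]
    (fun w => if (w.1 <= w.2)%R then pairing F G w.1 w.2 else 0).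
Proof.
move=> hF hG; apply: measurable_fun_ifT => //; last exact: measurable_pairing.
apply: (measurable_fun_ler measurable_fst measurable_snd).
Qed.

Lemma causal_form_le_full F G : nonneg_mfun F -> nonneg_mfun G ->
  causal_form F G <= full_form F G.
Proof.
move=> hF hG; apply: ge0_le_integralT => t.
  by apply: integral_ge0 => s _; case: ifP => // _; exact: pairing_ge0.
apply: ge0_le_integralT => s; case: ifP => // _; exact: pairing_ge0.
Qed.

Lemma causal_form_swap F G : nonneg_mfun F -> nonneg_mfun G ->
  causal_form F G =
  \int[leb]_s \int[leb]_t (if (s <= t)%R then pairing F G s t else 0).
Proof.
move=> hF hG; apply/esym.
apply: (fubini_tonelli (m1 := leb) (m2 := leb) _ (measurable_causal_pairing hF hG)).
by move=> w; case: ifP => // _; exact: pairing_ge0.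
Qed.

(** Tonelli exchanges the two times and [pairingC] the two functions, so swapping the arguments of
    the causal form amounts to integrating over the other half-plane. *)
Lemma causal_form_anticausal F G : nonneg_mfun F -> nonneg_mfun G ->
  causal_form F G =
  \int[leb]_t \int[leb]_s (if (t <= s)%R then pairing G F s t else 0).
Proof.
move=> hF hG; rewrite (causal_form_swap hF hG).
apply: eq_integral => s _; apply: eq_integral => t _.
by case: ifP => // _; exact: pairingC.
Qed.

(** The half-planes [s <= t] and [t <= s] cover the plane; only the diagonal is counted twice. *)
Lemma full_form_le_causal F G : nonneg_mfun F -> nonneg_mfun G ->
  full_form F G <= causal_form F G + causal_form G F.
Proof.
move=> hF hG; rewrite (causal_form_anticausal hG hF) /causal_form.
have mc := measurable_causal_pairing hF hG.
have mc' : measurable_fun [set: TR * TR]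
    (fun w => if (w.2 <= w.1)%R then pairing F G w.1 w.2 else 0).
  apply: measurable_fun_ifT => //; last exact: measurable_pairing.
  exact: (measurable_fun_ler measurable_snd measurable_fst).
have P0 s t : 0 <= pairing F G s t by exact: pairing_ge0.
have c0 (w : TR * TR) : 0 <= if (w.1 <= w.2)%R then pairing F G w.1 w.2 else 0.
  by case: ifP.
have c'0 (w : TR * TR) : 0 <= if (w.2 <= w.1)%R then pairing F G w.1 w.2 else 0.
  by case: ifP.
rewrite -ge0_integralD//.
- apply: ge0_le_integralT => t; first exact: integral_ge0.
  rewrite -ge0_integralD//.
  + apply: ge0_le_integralT => s //.
    by have [st|ts] := leP s t; [case: ifP => _;
        rewrite ?adde0 ?leeDl|rewrite (ltW ts) add0e].
  + by move=> s _; exact: (c0 (s, t)).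
  + exact: (measurableT_comp mc (pair2_measurable t)).
  + by move=> s _; exact: (c'0 (s, t)).
  + exact: (measurableT_comp mc' (pair2_measurable t)).
- by move=> t _; apply: integral_ge0 => s _; exact: (c0 (s, t)).
- exact: (measurable_fun_fubini_tonelli_G (m1 := leb) _ mc c0).
- by move=> t _; apply: integral_ge0 => s _; exact: (c'0 (s, t)).
- exact: (measurable_fun_fubini_tonelli_G (m1 := leb) _ mc' c'0).
Qed.

End transport_form.

(** * Time reversal *)

Section reflection.
Context (R : realType) (n : nat).
Local Notation X := (Rn R n * Rn R n)%type.
Local Notation TR := (measurableTypeR R).
Local Notation leb := (@lebesgue_measure R).
Local Notation m := (lebesgue_Rn R n).
Local Notation mx := (m \x m).
Implicit Types F G : R -> X -> R.

Definition reflection F : R -> X -> R := fun t z => F (- t)%R (reflect_v z).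

Lemma nonneg_mfun_reflection F : nonneg_mfun F -> nonneg_mfun (reflection F).
Proof.
move=> [mF F0]; split => [|t z]; last exact: F0.
rewrite (_ : uncurry _ = uncurry F \o (fun w : TR * X => ((- w.1)%R, reflect_v w.2))).
  apply: (measurableT_comp mF).
  apply/measurable_fun_pairP; split => /=.
    by apply: measurable_funN; exact: measurable_fst.
  exact: (measurableT_comp (measure_preserving_reflect_v R n).1 measurable_snd).
by apply/funext => -[].
Qed.

Lemma pairing_reflection F G s t : nonneg_mfun F -> nonneg_mfun G ->
  pairing (reflection G) (reflection F) s t = pairing F G (- t)%R (- s)%R.
Proof.
move=> hF hG; rewrite (pairingC _ _ hF hG) /pairing.
have mG : measurable_fun setT (fun z : X =>
    (G (- s)%R (shear (- t - - s)%R z))%:E * (F (- t)%R z)%:E).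
  apply: emeasurable_funM; last exact: nonneg_mfun_section.
  apply: (measurableT_comp (nonneg_mfun_section (- s)%R hG)).
  exact: (measure_preserving_shear n (- t - - s)%R).1.
rewrite -(measure_preserving_integral (measure_preserving_reflect_v R n) mG).
- apply: eq_integral => z _; rewrite /reflection reflect_v_shear.
  by rewrite -opprD opprB.
- by move=> z; rewrite mule_ge0 ?lee_fin; [|exact: hG.2|exact: hF.2].
Qed.

(** Reversal turns [s <= t] into [-t <= -s], which is causal again once the two functions change
    places. The equality thus exchanges the arguments while staying on the same half-plane. *)
Lemma causal_form_reflection F G : nonneg_mfun F -> nonneg_mfun G ->
  causal_form (reflection G) (reflection F) = causal_form F G.
Proof.
move=> hF hG; rewrite (causal_form_swap hF hG).
have P0 s t : 0 <= pairing F G s t by exact: pairing_ge0.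
have mc := measurable_causal_pairing hF hG.
have c0 (w : TR * TR) : 0 <= if (w.1 <= w.2)%R then pairing F G w.1 w.2 else 0.
  by case: ifP.
pose c s t := if (s <= t)%R then pairing F G s t else 0.
have mopp := measure_preserving_opp R.
transitivity (\int[leb]_t \int[leb]_s c (- t)%R s).
  apply: eq_integral => t _.
  rewrite -[RHS](measure_preserving_integral mopp (f := c (- t)%R)).
  - by apply: eq_integral => s _; rewrite /c lerN2 pairing_reflection.
  - exact: (measurableT_comp mc (pair1_measurable (- t)%R)).
  - by move=> s; exact: (c0 ((- t)%R, s)).
apply: (measure_preserving_integral mopp (f := fun t => \int[leb]_s c t s)).
  exact: (measurable_fun_fubini_tonelli_F (m2 := leb) _ mc c0).
by move=> t; apply: integral_ge0 => s _; exact: (c0 (t, s)).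
Qed.

Lemma norm_txv_reflection q r p F : 1 <= q -> 1 <= r -> 1 <= p ->
  nonneg_mfun F ->
  norm_txv q r p (fun t => EFin \o reflection F t) =
  norm_txv q r p (fun t => EFin \o F t).
Proof.
move=> q1 r1 p1 [mF _].
have mEF : measurable_fun [set: TR * X] (fun w => (F w.1 w.2)%:E).
  by apply/measurable_EFinP; rewrite (_ :
      (fun w => _) = uncurry F)//; apply/funext => -[].
have E t : norm_xv r p (EFin \o reflection F t) = norm_xv r p (EFin \o F (- t)%R).
  apply: eq_Lnorm => x.
  apply: (measure_preserving_Lnorm (measure_preserving_opp_coord R n)
      (f := fun v => (F (- t)%R (x, v))%:E)) => //.
  exact: (measurableT_comp mEF (measurableT_comp (pair1_measurable (- t)%R)
      (pair1_measurable x))).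
rewrite /norm_txv; under eq_Lnorm do rewrite E.
apply: (measure_preserving_Lnorm (measure_preserving_opp R)
    (f := fun t => norm_xv r p (EFin \o F t))) => //.
exact: (measurable_norm_xv r1 p1 mEF).
Qed.

Lemma norm_txv_shift a q r p F : 1 <= q -> 1 <= r -> 1 <= p ->
  nonneg_mfun F ->
  norm_txv q r p (fun t => EFin \o F (t + a)%R) =
  norm_txv q r p (fun t => EFin \o F t).
Proof.
move=> q1 r1 p1 [mF _].
have mEF : measurable_fun [set: TR * X] (fun w => (F w.1 w.2)%:E).
  by apply/measurable_EFinP; rewrite (_ :
      (fun w => _) = uncurry F)//; apply/funext => -[].
apply: (measure_preserving_Lnorm (measure_preserving_shift a)
    (f := fun t => norm_xv r p (EFin \o F t))) => //.
exact: (measurable_norm_xv r1 p1 mEF).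
Qed.

End reflection.

(** * Estimates as bounds of forms *)

(** Passes from a bound on the unit ball to a homogeneous one. For [y > 0] take [c = 1/y]; for
    [y = 0] every [c > 0] is admissible, which forces [x <= 0]. *)
Lemma lee_of_scaling (R : realType) (x y : \bar R) (C : R) : 0 <= y -> y < +oo ->
  (forall c : R, (0 < c)%R -> c%:E * y <= 1 -> c%:E * x <= C%:E) ->
  x <= C%:E * y.
Proof.
case: y => [y| |] // y0 _ h.
move: y0; rewrite lee_fin le_eqVlt => /predU1P[y0|y0]; last first.
  have := h y^-1%R; rewrite invr_gt0 => /(_ y0).
  rewrite -EFinM mulVf ?gt_eqF// => /(_ (lexx _)).
  by rewrite lee_pdivrMl// muleC.
rewrite -y0 mule0 leNgt; apply/negP => x0.
have {}h c : (0 < c)%R -> c%:E * x <= C%:E.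
  by move=> c0; apply: h => //; rewrite -y0 mule0.
case: x x0 h => [x||//] x0 h; last by have := h 1%R ltr01; rewrite mul1e.
rewrite lte_fin in x0.
(* With this factor [c * x] equals [|C| + 1], which exceeds [C]. *)
have c0 : (0 < (`|C| + 1) / x)%R by rewrite divr_gt0// ltr_wpDl.
have := h _ c0; rewrite -EFinM lee_fin divfK ?gt_eqF//.
by apply/negP; rewrite -ltNge (le_lt_trans (ler_norm C))// ltrDl.
Qed.

Section W_form.
Context (R : realType) (n : nat).
Local Notation X := (Rn R n * Rn R n)%type.
Local Notation TR := (measurableTypeR R).
Local Notation leb := (@lebesgue_measure R).
Local Notation m := (lebesgue_Rn R n).
Local Notation mx := (m \x m).
Implicit Types F G : R -> X -> R.

Lemma WE F t z : W F t z =
  \int[leb]_s (if (s <= t)%R then (F s (shear (t - s)%R z))%:E else 0).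
Proof.
rewrite /W integral_mkcond; apply: eq_integral => s _.
by rewrite patchE mem_setE.
Qed.

Let measurable_W_integrand F : nonneg_mfun F ->
  measurable_fun [set: (TR * X) * TR] (fun w =>
    if (w.2 <= w.1.1)%R then (F w.2 (shear (w.1.1 - w.2)%R w.1.2))%:E else 0).
Proof.
move=> hF.
have m11 : measurable_fun [set: (TR * X) * TR] (fun w => w.1.1).
  exact: (measurableT_comp measurable_fst measurable_fst).
apply: measurable_fun_ifT.
- exact: (measurable_fun_ler measurable_snd m11).
- apply: (measurableT_comp (measurable_transport hF)
    (g := fun w : (TR * X) * TR => ((w.2, w.1.1), w.1.2))).
  apply/measurable_fun_pairP; split => /=.
    by apply/measurable_fun_pairP; split => //=; exact: measurable_snd.
  exact: (measurableT_comp measurable_snd measurable_fst).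
- exact: measurable_cst.
Qed.

Lemma W_ge0 F t z : nonneg_mfun F -> 0 <= W F t z.
Proof.
by move=> hF; apply: integral_ge0 => s _; rewrite lee_fin; exact: hF.2.
Qed.

Lemma measurable_W F : nonneg_mfun F ->
  measurable_fun [set: TR * X] (uncurry (W F)).
Proof.
move=> hF; rewrite (_ : uncurry _ = fun w : TR * X => \int[leb]_s
    (if (s <= w.1)%R then (F s (shear (w.1 - s)%R w.2))%:E else 0)); last first.
  by apply/funext => -[t z]; exact: WE.
apply: (measurable_fun_fubini_tonelli_F (m2 := leb) _ (measurable_W_integrand hF)).
by move=> w; case: ifP => // _; rewrite lee_fin; exact: hF.2.
Qed.

(** This includes the points where the integral diverges, the right side being [+oo] there. *)
Lemma abse_W_le F t z : measurable_fun [set: TR * X] (uncurry F) ->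
  `|W F t z| <= W (fun s z => `|F s z|%R) t z.
Proof.
move=> mF; rewrite /W.
have mD : measurable [set s : TR | (s <= t)%R].
  exact: (measurable_itv `]-oo, t]).
apply: (le_abse_integral leb mD).
apply/measurable_EFinP; apply: measurable_funTS.
apply: (measurableT_comp mF (g := fun s : TR => (s, shear (t - s)%R z))).
apply/measurable_fun_pairP; split => /=; first exact: measurable_id.
apply: (measurableT_comp (@measurable_shear R n) (g := fun s : TR => ((t - s)%R, z))).
apply/measurable_fun_pairP; split => /=; last exact: measurable_cst.
by apply: measurable_funB; [exact: measurable_cst|exact: measurable_id].
Qed.

Lemma integral_W F G : nonneg_mfun F -> nonneg_mfun G ->
  \int[leb]_t \int[mx]_z (W F t z * (G t z)%:E) = causal_form F G.
Proof.
move=> hF hG; apply: eq_integral => t _.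
pose k := fun w : X * TR => (if (w.2 <= t)%R
  then (F w.2 (shear (t - w.2)%R w.1))%:E else 0) * (G t w.1)%:E.
have k0 w : 0 <= k w.
  rewrite /k mule_ge0 ?lee_fin//; last exact: hG.2.
  by case: ifP => // _; rewrite lee_fin; exact: hF.2.
have mkF : measurable_fun [set: X * TR] (fun w => if (w.2 <= t)%R
    then (F w.2 (shear (t - w.2)%R w.1))%:E else 0).
  apply: (measurableT_comp (measurable_W_integrand hF)
    (g := fun w : X * TR => ((t, w.1), w.2))).
  apply/measurable_fun_pairP; split; last exact: measurable_snd.
  by apply/measurable_fun_pairP; split; [exact: measurable_cst|exact: measurable_fst].
have mk : measurable_fun [set: X * TR] k.
  apply: emeasurable_funM => //.
  exact: (measurableT_comp (nonneg_mfun_section t hG) measurable_fst).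
transitivity (\int[mx]_z \int[leb]_s k (z, s)).
  apply: eq_integral => z _; rewrite WE -ge0_integralZr//.
  - exact: (measurableT_comp mkF (pair1_measurable z)).
  - by move=> s _; case: ifP => // _; rewrite lee_fin; exact: hF.2.
  - by rewrite lee_fin; exact: hG.2.
apply: etrans (fubini_tonelli (m1 := sigma_finite_product m m) (m2 := leb) _ mk k0) _.
apply: eq_integral => s _; rewrite /k /=; case: ifP => // _.
by rewrite integral0_eq// => z _; rewrite mul0e.
Qed.

End W_form.

Section bounded_forms.
Context (R : realType) (n : nat).
Local Notation X := (Rn R n * Rn R n)%type.
Local Notation TR := (measurableTypeR R).
Local Notation leb := (@lebesgue_measure R).
Local Notation m := (lebesgue_Rn R n).
Local Notation mx := (m \x m).
Implicit Types (F G : R -> X -> R) (f : X -> R).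

Lemma nonneg_mfunZ (c : R) F : (0 <= c)%R -> nonneg_mfun F ->
  nonneg_mfun (fun t z => c * F t z)%R.
Proof.
move=> c0 [mF F0]; split => [|t z]; last by rewrite mulr_ge0.
rewrite (_ : uncurry _ = fun w => (c * uncurry F w)%R); last by apply/funext => -[].
by apply: measurable_funM => //; exact: measurable_cst.
Qed.

Lemma nonneg_mfun_EFin F : nonneg_mfun F ->
  measurable_fun [set: TR * X] (fun w => (F w.1 w.2)%:E).
Proof.
move=> [mF _]; apply/measurable_EFinP.
by rewrite (_ : (fun w => _) = uncurry F)//; apply/funext => -[].
Qed.

Lemma norm_xvZ b c (k : R) f : 1 <= b -> 1 <= c -> (0 <= k)%R ->
  measurable_fun setT f ->
  norm_xv b c (EFin \o (fun z => k * f z)%R) = k%:E * norm_xv b c (EFin \o f).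
Proof.
move=> b1 c1 k0 /measurable_EFinP mf; rewrite -ge0_LnormZ//.
  apply: eq_Lnorm => x; rewrite -ge0_LnormZ//.
  exact: (measurableT_comp mf (pair1_measurable x)).
exact: (measurable_Lnorm _ c1 mf).
Qed.

Lemma norm_txvZ q r p (k : R) F : 1 <= q -> 1 <= r -> 1 <= p -> (0 <= k)%R ->
  nonneg_mfun F ->
  norm_txv q r p (fun t => EFin \o (fun z => k * F t z)%R) =
  k%:E * norm_txv q r p (fun t => EFin \o F t).
Proof.
move=> q1 r1 p1 k0 hF; rewrite -ge0_LnormZ//.
  apply: eq_Lnorm => t; apply: norm_xvZ => //.
  by apply/measurable_EFinP; exact: nonneg_mfun_section.
exact: (measurable_norm_xv r1 p1 (nonneg_mfun_EFin hF)).
Qed.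

Lemma pairingZ (k : R) F G s t : (0 <= k)%R -> nonneg_mfun F -> nonneg_mfun G ->
  pairing (fun t z => k * F t z)%R G s t = k%:E * pairing F G s t.
Proof.
move=> k0 hF hG; rewrite /pairing -ge0_integralZl//.
- by apply: eq_integral => z _; rewrite EFinM muleA.
- exact: (measurableT_comp (measurable_pairing_integrand hF hG)
    (pair1_measurable (s, t))).
- by move=> z _; rewrite mule_ge0 ?lee_fin; [|exact: hF.2|exact: hG.2].
Qed.

Lemma causal_formZ (k : R) F G : (0 <= k)%R -> nonneg_mfun F -> nonneg_mfun G ->
  causal_form (fun t z => k * F t z)%R G = k%:E * causal_form F G.
Proof.
move=> k0 hF hG; have mc := measurable_causal_pairing hF hG.
have c0 (w : TR * TR) : 0 <= if (w.1 <= w.2)%R then pairing F G w.1 w.2 else 0.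
  by case: ifP => // _; exact: pairing_ge0.
rewrite /causal_form -ge0_integralZl//; last 2 first.
- exact: (measurable_fun_fubini_tonelli_G (m1 := leb) _ mc c0).
- by move=> t _; apply: integral_ge0 => s _; exact: (c0 (s, t)).
apply: eq_integral => t _; rewrite -ge0_integralZl//.
- apply: eq_integral => s _; case: ifP => _; last by rewrite mule0.
  exact: pairingZ.
- exact: (measurableT_comp mc (pair2_measurable t)).
- by move=> s _; exact: (c0 (s, t)).
Qed.

Definition unit_txv q r p F :=
  nonneg_mfun F /\ norm_txv q r p (fun t => EFin \o F t) <= 1.

(** Testing on unit balls keeps products of norms such as [0 * +oo] out of the bound. The exponents
    [e1 e2 e3] are meant to be the conjugates of those of the target space. *)
Definition bounded_form (Phi : (R -> X -> R) -> (R -> X -> R) -> \bar R)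
    a1 a2 a3 e1 e2 e3 :=
  exists2 C : R, (0 < C)%R & forall F G,
    unit_txv a1 a2 a3 F -> unit_txv e1 e2 e3 G -> Phi F G <= C%:E.

(** Hölder gives the form from the estimate. Conversely, the estimate is reduced to nonnegative
    functions, then [norm_txv_dual] supplies a unit [G] and [lee_of_scaling] normalises [F]. *)
Lemma lesssim_W_bounded_form q r p a1 a2 a3 :
  1 <= q -> 1 <= r -> 1 <= p -> 1 <= a1 -> 1 <= a2 -> 1 <= a3 ->
  lesssim (@L_txv R n a1 a2 a3) (fun F => norm_txv q r p (W F))
    (fun F => norm_txv a1 a2 a3 (fun t => EFin \o F t)) <->
  bounded_form (@causal_form R n) a1 a2 a3 (hoelder_conjugate q)
    (hoelder_conjugate r) (hoelder_conjugate p).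
Proof.
move=> q1 r1 p1 a11 a21 a31; split=> -[C C0 hC]; exists C => //.
  move=> F G [hF NF] [hG NG]; rewrite -(integral_W hF hG).
  apply: (le_trans (norm_txv_hoelder q1 r1 p1 _ _ _ _)).
  - exact: measurable_W.
  - rewrite (_ : uncurry _ = EFin \o uncurry G); last by apply/funext => -[].
    by apply/measurable_EFinP; exact: hG.1.
  - by move=> t z; exact: W_ge0.
  - by move=> t z; rewrite lee_fin; exact: hG.2.
  have LF : L_txv a1 a2 a3 F by split; [exact: hF.1|exact: (le_lt_trans NF (ltry 1%R))].
  rewrite -[leRHS]mule1 -[C%:E]mule1.
  apply: lee_pmul => //; first exact: norm_txv_ge0.
    exact: norm_txv_ge0.
  apply: (le_trans (hC _ LF)); apply: lee_wpmul2l => //.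
  by rewrite lee_fin ltW.
(* Replacing [F] by its absolute value keeps the right side of the estimate and can only increase
   the left one. *)
move=> F [mF NF]; pose F0 t z := `|F t z|%R.
have hF0 : nonneg_mfun F0.
  split => [|t z]; last exact: normr_ge0.
  rewrite (_ : uncurry _ = fun w => `|uncurry F w|%R).
    exact: measurableT_comp.
  by apply/funext => -[].
have NF0 : norm_txv a1 a2 a3 (fun t => EFin \o F0 t) =
    norm_txv a1 a2 a3 (fun t => EFin \o F t).
  by apply/eqP; rewrite eq_le; apply/andP; split; apply: le_norm_txv => // t z;
    rewrite /= /F0 normr_id.
rewrite -NF0; apply: (@le_trans _ _ (norm_txv q r p (W F0))).
  apply: le_norm_txv => // t z; rewrite [leRHS]gee0_abs; last exact: W_ge0.
  exact: abse_W_le.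
apply: norm_txv_dual => //.
- exact: measurable_W.
- by move=> t z; exact: W_ge0.
- move=> G mG G0 NG; have hG : nonneg_mfun G by split.
  rewrite (integral_W hF0 hG); apply: lee_of_scaling.
  + exact: norm_txv_ge0.
  + by rewrite NF0.
  + move=> c c0 cN; rewrite -(causal_formZ (ltW c0) hF0 hG); apply: hC; last by split.
    split; first exact: (nonneg_mfunZ (ltW c0)).
    by rewrite (norm_txvZ a11 a21 a31 (ltW c0) hF0).
Qed.

Definition free_form f G :=
  \int[leb]_t \int[mx]_z ((f (shear t z))%:E * (G t z)%:E).

(** Homogeneous in [f], as in the estimate for [U]: duality normalises only [G]. *)
Definition bounded_free_form b c e1 e2 e3 :=
  exists2 C : R, (0 < C)%R & forall f G,
    measurable_fun setT f -> (forall z, 0 <= f z)%R ->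
    norm_xv b c (EFin \o f) < +oo -> unit_txv e1 e2 e3 G ->
    free_form f G <= C%:E * norm_xv b c (EFin \o f).

Lemma measurable_free f : measurable_fun setT f ->
  measurable_fun [set: TR * X] (fun w => (f (shear w.1 w.2))%:E).
Proof.
by move=> mf; apply/measurable_EFinP;
    exact: (measurableT_comp mf (@measurable_shear R n)).
Qed.

Lemma lesssim_U_bounded_free_form q r p b c :
  1 <= q -> 1 <= r -> 1 <= p -> 1 <= b -> 1 <= c ->
  lesssim (@L_xv R n b c) (fun f => norm_txv q r p (fun t => EFin \o U t f))
    (fun f => norm_xv b c (EFin \o f)) <->
  bounded_free_form b c (hoelder_conjugate q) (hoelder_conjugate r)
    (hoelder_conjugate p).
Proof.
move=> q1 r1 p1 b1 c1; split=> -[C C0 hC]; exists C => //.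
  move=> f G mf f0 Nf [hG NG].
  apply: (le_trans (norm_txv_hoelder (F := fun t => EFin \o U t f) q1 r1 p1 _ _ _ _)).
  - rewrite (_ : uncurry _ = fun w : TR * X => (f (shear w.1 w.2))%:E).
      exact: measurable_free.
    by apply/funext => -[].
  - rewrite (_ : uncurry _ = EFin \o uncurry G); last by apply/funext => -[].
    by apply/measurable_EFinP; exact: hG.1.
  - by move=> t z; rewrite lee_fin; exact: f0.
  - by move=> t z; rewrite lee_fin; exact: hG.2.
  rewrite -[leRHS]mule1; apply: lee_pmul => //; try exact: norm_txv_ge0.
  by apply: hC.
move=> f [mf Nf]; pose f0 z := `|f z|%R.
have mf0 : measurable_fun setT f0 by exact: measurableT_comp.
have Nf0 : norm_xv b c (EFin \o f0) = norm_xv b c (EFin \o f).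
  by apply/eqP; rewrite eq_le; apply/andP; split; apply: le_norm_xv => // z;
    rewrite /= /f0 normr_id.
rewrite -Nf0.
apply: (@le_trans _ _ (norm_txv q r p (fun t => EFin \o U t f0))).
  by apply: le_norm_txv => // t z; rewrite /= /U /f0 normr_id.
apply: norm_txv_dual => //.
- rewrite (_ : uncurry _ = fun w : TR * X => (f0 (shear w.1 w.2))%:E).
    exact: measurable_free.
  by apply/funext => -[].
- by move=> t z; rewrite lee_fin /U /f0.
- move=> G mG G0 NG; apply: (hC f0 G mf0 (fun z => normr_ge0 _)).
    by rewrite Nf0.
  by split.
Qed.

(** For fixed [s], translating time by [s] turns the integral of [pairing F G s] into the free form
    of [F s] and a translate of [G], still a unit function. Integrating the resulting bound in [s]
    produces the exponent 1 in time. *)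
Lemma bounded_free_form_full b c e1 e2 e3 :
  1 <= b -> 1 <= c -> 1 <= e1 -> 1 <= e2 -> 1 <= e3 ->
  bounded_free_form b c e1 e2 e3 ->
  bounded_form (@full_form R n) 1 b c e1 e2 e3.
Proof.
move=> b1 c1 e11 e21 e31 [C C0 hC]; exists C => // F G [hF NF] [hG NG].
have mN := measurable_norm_xv b1 c1 (nonneg_mfun_EFin hF).
apply: (@le_trans _ _ (\int[leb]_s (C%:E * norm_xv b c (EFin \o F s)))); last first.
  rewrite ge0_integralZl//; last 2 first.
  - by move=> s _; exact: norm_xv_ge0.
  - by rewrite lee_fin ltW.
  rewrite -[leRHS]mule1; apply: lee_wpmul2l; first by rewrite lee_fin ltW.
  apply: le_trans NF; rewrite /norm_txv Lnorm1.
  by under [leRHS]eq_integral do rewrite gee0_abs ?norm_xv_ge0//.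
have -> : full_form F G = \int[leb]_s \int[leb]_t pairing F G s t.
  apply/esym; apply: (fubini_tonelli (m1 := leb) (m2 := leb)
      _ (measurable_pairing hF hG)).
  by move=> w; exact: pairing_ge0.
apply: ge0_le_integralT => s.
  by apply: integral_ge0 => t _; exact: pairing_ge0.
(* A slice of infinite norm is bounded trivially because [C > 0]. *)
have [Noo|] := eqVneq (norm_xv b c (EFin \o F s)) +oo.
  by rewrite Noo gt0_muley ?lte_fin// leey.
rewrite -ltey => NFs.
have hGs : unit_txv e1 e2 e3 (fun t => G (t + s)%R).
  split; last by rewrite norm_txv_shift.
  split => [|t z]; last exact: hG.2.
  rewrite (_ : uncurry _ = uncurry G \o
      (fun w : TR * X => ((w.1 + s)%R, w.2))); last first.
    by apply/funext => -[].
  apply: (measurableT_comp hG.1).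
  apply/measurable_fun_pairP; split; last exact: measurable_snd.
  by apply: measurable_funD; [exact: measurable_fst|exact: measurable_cst].
have mFs : measurable_fun setT (F s).
  by apply/measurable_EFinP; exact: nonneg_mfun_section.
apply: le_trans (hC _ _ mFs (hF.2 s) NFs hGs).
rewrite -(measure_preserving_integral (measure_preserving_shift s)
    (f := pairing F G s)).
- by rewrite /free_form /pairing; under eq_integral do rewrite addrK.
- exact: (measurableT_comp (measurable_pairing hF hG) (pair1_measurable s)).
- by move=> t; exact: pairing_ge0.
Qed.

End bounded_forms.

(** * Concentration in time *)

Section window_average.
Context (R : realType).
Local Notation TR := (measurableTypeR R).
Local Notation leb := (@lebesgue_measure R).

Let radius (k : nat) : R := (k.+1%:R^-1)%R.

Let radius_gt0 k : (0 < radius k)%R.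
Proof. by rewrite invr_gt0. Qed.

(** The [phi_k] of the overview: the indicator of []-r, r[] with [r = 1/(k+1)], divided by its
    length [2r]. *)
Definition window (k : nat) (s : R) : R :=
  (\1_(ball (0%R : R) (radius k)) s * (radius k *+ 2)^-1)%R.

Lemma window_ge0 k s : (0 <= window k s)%R.
Proof. by rewrite mulr_ge0// invr_ge0 mulrn_wge0// ltW. Qed.

Lemma measurable_window k : measurable_fun [set: TR] (window k).
Proof.
apply: measurable_funM; last exact: measurable_cst.
by apply: measurable_indic; exact: measurable_ball.
Qed.

Lemma integral_window k : \int[leb]_s (window k s)%:E = 1.
Proof.
under eq_integral do rewrite EFinM.
have r0 : (0 <= radius k)%R by exact: ltW.
have mb : measurable (ball (0%R : R) (radius k)) by exact: measurable_ball.
rewrite ge0_integralZr//; last 2 first.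
- by apply/measurable_EFinP; exact: measurable_indic.
- by rewrite lee_fin invr_ge0 mulrn_wge0.
rewrite integral_indic// setIT /= lebesgue_measure_ball// -EFinM mulfV//.
by rewrite mulrn_eq0/= gt_eqF.
Qed.

(** The integral is the mean of [u] over the ball of radius [1/(k+1)] about [t], so this is
    Lebesgue's differentiation theorem; the bound [M] makes [u] locally integrable. *)
Lemma ae_cvg_window_average (u : R -> R) (M : R) :
  measurable_fun [set: TR] u -> (forall t, 0 <= u t <= M)%R ->
  \forall t \ae leb,
    \int[leb]_s (window k s * u (t - s))%:E @[k --> \oo] --> (u t)%:E.
Proof.
move=> mu uM.
have uloc : locally_integrable setT u.
  split => //; first exact: openT.
  move=> K _ cK; have mK := compact_measurable cK.
  apply: (@le_lt_trans _ _ (\int[leb]_(x in K) (cst M%:E) x)).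
    apply: ge0_le_integral => //=.
    - by apply/measurable_EFinP; apply: measurableT_comp => //; exact: measurable_funTS.
    - by move=> t _; have /andP[u0 ule] := uM t; rewrite lee_fin ger0_norm.
  rewrite integral_cst// lte_mul_pinfty ?lee_fin//.
    by have /andP[u0 ule] := uM 0%R; exact: le_trans ule.
  exact: compact_finite_measure.
pose E (x : R) (k : nat) : set R := ball x (radius k).
have hE x : nicely_shrinking x (E x).
  split => [k|]; first exact: measurable_ball.
  (* The shrinking sets are the balls themselves, hence the ratio 1. *)
  exists (1%R, fun k => PosNum (radius_gt0 k)); split => //=.
  - exact: cvg_harmonic.
  - by move=> k y.
  - by move=> k; rewrite mul1e.
have := lebesgue_differentiation uloc; apply: filterS.
  exact: (ae_filter_ringOfSetsType leb).
move=> t /(nice_lebesgue_differentiation hE uloc).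
rewrite (_ : (fun k => (leb (E t k))^-1 * \int[leb]_(y in E t k) (u y)%:E) =
  (fun k => \int[leb]_s (window k s * u (t - s))%:E)) //; apply/funext => k.
have r0 : (0 <= radius k)%R by exact: ltW.
rewrite /= lebesgue_measure_ball// inver mulrn_eq0/= gt_eqF//.
pose f (y : TR) : \bar R := ((radius k *+ 2)^-1)%:E * ((u y)%:E * (\1_(E t k) y)%:E).
have mE : measurable (E t k : set TR) by exact: measurable_ball.
have mf1 : measurable_fun [set: TR] (fun y => (u y)%:E * (\1_(E t k) y)%:E).
  apply: emeasurable_funM; first exact/measurable_EFinP.
  by apply/measurable_EFinP; exact: measurable_indic.
have u0 y : (0 <= u y)%R by have /andP[] := uM y.
have f10 y : 0 <= (u y)%:E * (\1_(E t k) y)%:E by rewrite mule_ge0 ?lee_fin.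
have c0 : (0 <= (radius k *+ 2)^-1)%R by rewrite invr_ge0 mulrn_wge0.
transitivity (\int[leb]_y f y).
  rewrite ge0_integralZl//; congr (_ * _).
  rewrite [LHS]integral_mkcond; apply: eq_integral => y _.
  by rewrite patchE indicE; case: (_ \in _); rewrite ?mule1 ?mule0.
(* The change of variable [y = t - s], as a reflection followed by a translation. *)
have mp := measure_preserving_comp (measure_preserving_shift t) (measure_preserving_opp R).
rewrite -(measure_preserving_integral mp (f := f)).
- apply: eq_integral => s _.
  have Es : \1_(E t k) (- s + t)%R = \1_(ball (0%R : R) (radius k)) s :> R.
    rewrite !indicE; congr (_%:R); congr nat_of_bool.
    apply/idP/idP => /set_mem h; apply/mem_set; move: h;
      by rewrite /E /ball/= ?sub0r ?normrN opprD opprK addrCA subrr addr0.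
  rewrite /f /window /= Es -!EFinM (addrC _ t); congr EFin.
  by rewrite mulrCA mulrC (mulrC _ (\1_ _ _)).
- by apply: emeasurable_funM => //; exact: measurable_cst.
- by move=> y; rewrite mule_ge0// lee_fin.
Qed.

End window_average.

Lemma limn_einf_le (R : realType) (u : (\bar R)^nat) (K : \bar R) :
  (forall k, u k <= K) -> limn_einf u <= K.
Proof.
move=> uK; rewrite limn_einf_lim; apply: lime_le; first exact: is_cvg_einfs.
apply: nearW => k; apply: le_trans (uK k); apply: ereal_inf_lbound.
by exists k => //=.
Qed.

Lemma measurable_limn_einf d (T : measurableType d) (R : realType)
    (h : (T -> \bar R)^nat) :
  (forall k, measurable_fun setT (h k)) ->
  measurable_fun setT (fun x => limn_einf (h ^~ x)).
Proof.
move=> mh; rewrite /limn_einf; apply: measurableT_comp => //.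
apply: (measurable_fun_limn_esup (f := fun k x => - h k x)) => k.
exact: measurableT_comp.
Qed.

Section full_form_free.
Context (R : realType) (n : nat).
Local Notation X := (Rn R n * Rn R n)%type.
Local Notation TR := (measurableTypeR R).
Local Notation leb := (@lebesgue_measure R).
Local Notation m := (lebesgue_Rn R n).
Local Notation mx := (m \x m).
Implicit Types (F G : R -> X -> R) (f : X -> R).

Let pulse k f : R -> X -> R := fun s z => (window k s * f z)%R.

(** For fixed [z], the convolution of [window k] with the trajectory [t |-> f (shear t z)]. *)
Let average k f t z := \int[leb]_s (pulse k f s (shear (t - s)%R z))%:E.

Let nonneg_mfun_pulse k f : measurable_fun setT f -> (forall z, 0 <= f z)%R ->
  nonneg_mfun (pulse k f).
Proof.
move=> mf f0; split => [|t z]; last by rewrite mulr_ge0// window_ge0.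
rewrite (_ : uncurry _ = fun w : TR * X => (window k w.1 * f w.2)%R); last first.
  by apply/funext => -[].
apply: measurable_funM.
  exact: (measurableT_comp (measurable_window k) measurable_fst).
exact: (measurableT_comp mf measurable_snd).
Qed.

(** The time exponent 1 makes this independent of [k], since every window has integral 1. *)
Let norm_txv_pulse k b c f : 1 <= b -> 1 <= c -> measurable_fun setT f ->
  norm_txv 1 b c (fun s => EFin \o pulse k f s) = norm_xv b c (EFin \o f).
Proof.
move=> b1 c1 mf; rewrite /norm_txv Lnorm1.
under eq_integral do rewrite norm_xvZ ?window_ge0//
    gee0_abs ?mule_ge0 ?norm_xv_ge0 ?lee_fin ?window_ge0//.
rewrite ge0_integralZr ?integral_window ?mul1e//.
- by apply/measurable_EFinP; exact: measurable_window.
- by move=> s _; rewrite lee_fin window_ge0.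
- exact: norm_xv_ge0.
Qed.

Let average_ge0 k f t z : (forall z, 0 <= f z)%R -> 0 <= average k f t z.
Proof.
by move=> f0; apply: integral_ge0 => s _; rewrite lee_fin mulr_ge0// window_ge0.
Qed.

Let measurable_average k f : measurable_fun setT f -> (forall z, 0 <= f z)%R ->
  measurable_fun [set: TR * X] (fun w => average k f w.1 w.2).
Proof.
move=> mf f0; have hp := nonneg_mfun_pulse k mf f0.
have mK : measurable_fun [set: (TR * X) * TR] (fun w =>
    (pulse k f w.2 (shear (w.1.1 - w.2)%R w.1.2))%:E).
  apply: (measurableT_comp (measurable_transport hp)
    (g := fun w : (TR * X) * TR => ((w.2, w.1.1), w.1.2))).
  apply/measurable_fun_pairP; split.
    apply/measurable_fun_pairP; split; first exact: measurable_snd.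
    exact: (measurableT_comp measurable_fst measurable_fst).
  exact: (measurableT_comp measurable_snd measurable_fst).
apply: (measurable_fun_fubini_tonelli_F (m2 := leb) _ mK).
by move=> w; rewrite lee_fin; exact: hp.2.
Qed.

(** The variable [z] is put outermost because differentiation takes place in [t], along the
    trajectory of each [z]. *)
Let full_form_pulse k f G : measurable_fun setT f -> (forall z, 0 <= f z)%R ->
  nonneg_mfun G ->
  full_form (pulse k f) G =
  \int[mx]_z \int[leb]_t (average k f t z * (G t z)%:E).
Proof.
move=> mf f0 hG; have hp := nonneg_mfun_pulse k mf f0.
have mAG : measurable_fun [set: TR * X] (fun w => average k f w.1 w.2 * (G w.1 w.2)%:E).
  apply: emeasurable_funM; first exact: measurable_average.
  exact: nonneg_mfun_EFin.
transitivity (\int[leb]_t \int[mx]_z (average k f t z * (G t z)%:E)); last first.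
  apply: (fubini_tonelli (m1 := leb) (m2 := sigma_finite_product m m) _ mAG).
  by move=> w; rewrite mule_ge0 ?lee_fin; [|exact: average_ge0|exact: hG.2].
apply: eq_integral => t _.
have mI := measurable_pairing_integrand hp hG.
have mI' : measurable_fun [set: TR * X] (fun w : TR * X =>
    (pulse k f w.1 (shear (t - w.1)%R w.2))%:E * (G t w.2)%:E).
  apply: (measurableT_comp mI (g := fun w : TR * X => ((w.1, t), w.2))).
  apply/measurable_fun_pairP; split; last exact: measurable_snd.
  by apply/measurable_fun_pairP; split; [exact: measurable_fst|exact: measurable_cst].
transitivity (\int[mx]_z \int[leb]_s
    ((pulse k f s (shear (t - s)%R z))%:E * (G t z)%:E)).
  apply: (fubini_tonelli (m1 := leb) (m2 := sigma_finite_product m m) _ mI').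
  by move=> w; rewrite mule_ge0 ?lee_fin; [|exact: hp.2|exact: hG.2].
apply: eq_integral => z _; rewrite ge0_integralZr//.
- apply: (measurableT_comp (measurable_transport hp) (g := fun s : TR => ((s, t), z))).
  apply/measurable_fun_pairP; split; last exact: measurable_cst.
  by apply/measurable_fun_pairP; split; [exact: measurable_id|exact: measurable_cst].
- by move=> s _; rewrite lee_fin; exact: hp.2.
- by rewrite lee_fin; exact: hG.2.
Qed.

(** Fatou's lemma is used twice, in [z] outside and in [t] inside. The exceptional null set of times
    may depend on [z]. *)
Let free_form_le_bounded f G (M : R) (K : \bar R) :
  measurable_fun setT f -> (forall z, 0 <= f z <= M)%R -> nonneg_mfun G ->
  (forall k, full_form (pulse k f) G <= K) -> free_form f G <= K.
Proof.
move=> mf fM hG hK; have f0 z : (0 <= f z)%R by have /andP[] := fM z.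
have mFG : measurable_fun [set: TR * X]
    (fun w => (f (shear w.1 w.2))%:E * (G w.1 w.2)%:E).
  by apply: emeasurable_funM; [exact: measurable_free|exact: nonneg_mfun_EFin].
have FG0 (w : TR * X) : 0 <= (f (shear w.1 w.2))%:E * (G w.1 w.2)%:E.
  by rewrite mule_ge0 ?lee_fin//; exact: hG.2.
pose a k t z := average k f t z * (G t z)%:E.
have ma k : measurable_fun [set: TR * X] (fun w => a k w.1 w.2).
  apply: emeasurable_funM; first exact: measurable_average.
  exact: nonneg_mfun_EFin.
have a0 k t z : 0 <= a k t z.
  by rewrite mule_ge0 ?lee_fin; [|exact: average_ge0|exact: hG.2].
have -> : free_form f G = \int[mx]_z \int[leb]_t ((f (shear t z))%:E * (G t z)%:E).
  exact: (fubini_tonelli (m1 := leb) (m2 := sigma_finite_product m m) _ mFG FG0).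
apply: (@le_trans _ _ (\int[mx]_z limn_einf
    (fun k => \int[leb]_t a k t z))); last first.
  apply: le_trans (fatou _ _ _ _) _ => //.
  - move=> k; apply: (measurable_fun_fubini_tonelli_G (m1 := leb) _ (ma k)).
    by move=> w; exact: a0.
  - by move=> k z _; apply: integral_ge0.
  by apply: limn_einf_le => k; rewrite -full_form_pulse.
apply: ge0_le_integralT => z; first by apply: integral_ge0 => t _; exact: (FG0 (t, z)).
have maz k : measurable_fun [set: TR] (fun t => a k t z).
  exact: (measurableT_comp (ma k) (pair2_measurable z)).
apply: (@le_trans _ _ (\int[leb]_t limn_einf (fun k => a k t z))); last first.
  by apply: fatou.
apply: ae_ge0_le_integral => //.
- by move=> t _; exact: (FG0 (t, z)).
- exact: (measurableT_comp mFG (pair2_measurable z)).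
- move=> t _; rewrite limn_einf_lim; apply: lime_ge; first exact: is_cvg_einfs.
  by apply: nearW => k; apply: le_ereal_inf_tmp => _ [l /= _ <-].
- exact: measurable_limn_einf.
have mu : measurable_fun [set: TR] (fun t => f (shear t z)).
  exact: (measurableT_comp mf (measurableT_comp (@measurable_shear R n) (pair2_measurable z))).
have := ae_cvg_window_average mu (fun t => fM (shear t z)).
apply: filterS; first exact: (ae_filter_ringOfSetsType leb).
move=> t ut _.
suff /cvg_limn_einf_sup[-> _] : (a ^~ t) ^~ z @ \oo --> (f (shear t z))%:E * (G t z)%:E by [].
(* For fixed [t] and [z], the factor [G t z] is a finite constant. *)
by apply: cvgeZr.
Qed.

(** Truncation at height [j] reduces to the bounded case; at each point the truncated values are
    eventually constant in [j], and Fatou removes the truncation. *)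
Let free_form_le f G (K : \bar R) :
  measurable_fun setT f -> (forall z, 0 <= f z)%R -> nonneg_mfun G ->
  (forall j k, full_form (pulse k (fun z => Num.min (f z) j%:R)) G <= K) ->
  free_form f G <= K.
Proof.
move=> mf f0 hG hK; pose trunc (j : nat) z := Num.min (f z) j%:R.
have t0 j z : (0 <= trunc j z)%R by rewrite le_min f0 ler0n.
have mtr j : measurable_fun setT (trunc j).
  by apply: measurable_minr => //; exact: measurable_cst.
have trK j : free_form (trunc j) G <= K.
  apply: (@free_form_le_bounded _ _ j%:R _ (mtr j) _ hG (hK j)) => z.
  by rewrite t0/= ge_min lexx orbT.
pose b j t z := (trunc j (shear t z))%:E * (G t z)%:E.
have mb j : measurable_fun [set: TR * X] (fun w => b j w.1 w.2).
  by apply: emeasurable_funM; [exact: measurable_free|exact: nonneg_mfun_EFin].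
have b0 j t z : 0 <= b j t z.
  by rewrite mule_ge0 ?lee_fin//; exact: hG.2.
apply: (@le_trans _ _ (\int[leb]_t limn_einf
    (fun j => \int[mx]_z b j t z))); last first.
  apply: le_trans (fatou _ _ _ _) _ => //.
  - move=> j; apply: (measurable_fun_fubini_tonelli_F (m2 := sigma_finite_product m m) _ (mb j)).
    by move=> w; exact: b0.
  - by move=> j t _; apply: integral_ge0.
  by apply: limn_einf_le => j; exact: trK.
apply: ge0_le_integralT => t.
  by apply: integral_ge0 => z _; rewrite mule_ge0 ?lee_fin//; exact: hG.2.
apply: (@le_trans _ _ (\int[mx]_z limn_einf (fun j => b j t z))); last first.
  by apply: fatou => // j; exact: (measurableT_comp (mb j) (pair1_measurable t)).
apply: ge0_le_integralT => z; first by rewrite mule_ge0 ?lee_fin//; exact: hG.2.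
suff /cvg_limn_einf_sup[-> _] : (b ^~ t) ^~ z @ \oo --> (f (shear t z))%:E * (G t z)%:E by [].
apply: cvg_near_cst; exists (Num.truncn (f (shear t z))).+1 => // j /= fj.
rewrite /b /trunc min_l//.
by apply: le_trans (ltW (truncnS_gt _)) _; rewrite ler_nat.
Qed.

Let free_formZ (k : R) f G : (0 <= k)%R -> measurable_fun setT f ->
  (forall z, 0 <= f z)%R -> nonneg_mfun G ->
  free_form (fun z => k * f z)%R G = k%:E * free_form f G.
Proof.
move=> k0 mf f0 hG.
have mFG : measurable_fun [set: TR * X]
    (fun w => (f (shear w.1 w.2))%:E * (G w.1 w.2)%:E).
  by apply: emeasurable_funM; [exact: measurable_free|exact: nonneg_mfun_EFin].
have FG0 (w : TR * X) : 0 <= (f (shear w.1 w.2))%:E * (G w.1 w.2)%:E.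
  by rewrite mule_ge0 ?lee_fin//; exact: hG.2.
rewrite /free_form -ge0_integralZl//; last 2 first.
- exact: (measurable_fun_fubini_tonelli_F (m2 := sigma_finite_product m m) _ mFG FG0).
- by move=> t _; apply: integral_ge0 => z _; exact: (FG0 (t, z)).
apply: eq_integral => t _; rewrite -ge0_integralZl//.
- by apply: eq_integral => z _; rewrite EFinM muleA.
- exact: (measurableT_comp mFG (pair1_measurable t)).
- by move=> z _; exact: (FG0 (t, z)).
Qed.

(** Once [f] is scaled into the unit ball, all its truncated pulses are unit functions, so the
    single constant [C] bounds all their full forms. *)
Lemma bounded_form_full_free b c e1 e2 e3 : 1 <= b -> 1 <= c ->
  bounded_form (@full_form R n) 1 b c e1 e2 e3 ->
  bounded_free_form n b c e1 e2 e3.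
Proof.
move=> b1 c1 [C C0 hC]; exists C => // f G mf f0 Nf uG; have [hG _] := uG.
apply: lee_of_scaling => //; first exact: norm_xv_ge0.
move=> k k0 kN; rewrite -(free_formZ (ltW k0) mf f0 hG).
have mkf : measurable_fun setT (fun z => k * f z)%R.
  by apply: measurable_funM => //; exact: measurable_cst.
have kf0 z : (0 <= k * f z)%R by rewrite mulr_ge0// ltW.
apply: free_form_le => // j l; apply: hC => //.
have mt : measurable_fun setT (fun z => Num.min (k * f z) j%:R)%R.
  by apply: measurable_minr => //; exact: measurable_cst.
have t0 z : (0 <= Num.min (k * f z) j%:R)%R by rewrite le_min kf0 ler0n.
split; first exact: nonneg_mfun_pulse.
rewrite norm_txv_pulse//; apply: le_trans kN.
rewrite -(norm_xvZ b1 c1 (ltW k0) mf); apply: le_norm_xv => // z.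
by rewrite !gee0_abs ?lee_fin// ge_min lexx.
Qed.

End full_form_free.

(** * Causality and the energy space *)

Section causal_symmetry.
Context (R : realType) (n : nat).
Local Notation X := (Rn R n * Rn R n)%type.
Implicit Types F G : R -> X -> R.

Lemma bounded_causal_form_full a1 a2 a3 e1 e2 e3 :
  bounded_form (@full_form R n) a1 a2 a3 e1 e2 e3 ->
  bounded_form (@causal_form R n) a1 a2 a3 e1 e2 e3.
Proof.
move=> [C C0 hC]; exists C => [//|F G uF uG].
apply: le_trans (hC _ _ uF uG); apply: causal_form_le_full.
  exact: uF.1.
exact: uG.1.
Qed.

(** Reflections of unit functions are unit functions, and the form takes them in the other order,
    with the same constant. *)
Lemma bounded_causal_formC a1 a2 a3 e1 e2 e3 :
  1 <= a1 -> 1 <= a2 -> 1 <= a3 -> 1 <= e1 -> 1 <= e2 -> 1 <= e3 ->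
  bounded_form (@causal_form R n) a1 a2 a3 e1 e2 e3 ->
  bounded_form (@causal_form R n) e1 e2 e3 a1 a2 a3.
Proof.
move=> a11 a21 a31 e11 e21 e31 [C C0 hC]; exists C => // F G [hF NF] [hG NG].
rewrite -(causal_form_reflection hF hG); apply: hC; split.
- exact: nonneg_mfun_reflection.
- by rewrite norm_txv_reflection.
- exact: nonneg_mfun_reflection.
- by rewrite norm_txv_reflection.
Qed.

Lemma bounded_full_form_causal a1 a2 a3 e1 e2 e3 :
  1 <= a1 -> 1 <= a2 -> 1 <= a3 -> 1 <= e1 -> 1 <= e2 -> 1 <= e3 ->
  bounded_form (@causal_form R n) a1 a2 a3 e1 e2 e3 ->
  bounded_form (@full_form R n) a1 a2 a3 e1 e2 e3.
Proof.
move=> a11 a21 a31 e11 e21 e31 bC.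
have [C' C'0 hC'] := bounded_causal_formC a11 a21 a31 e11 e21 e31 bC.
have [C C0 hC] := bC; exists (C + C')%R; first exact: addr_gt0.
move=> F G uF uG; apply: le_trans (full_form_le_causal uF.1 uG.1) _.
by rewrite EFinD; apply: leeD; [exact: hC|exact: hC'].
Qed.

End causal_symmetry.

Section energy_space.
Context (R : realType) (n : nat).
Local Notation X := (Rn R n * Rn R n)%type.
Local Notation TR := (measurableTypeR R).
Local Notation leb := (@lebesgue_measure R).
Local Notation m := (lebesgue_Rn R n).
Local Notation mx := (m \x m).
Implicit Types (F G : R -> X -> R) (f : X -> R).

(** With equal exponents the outer power cancels the inner root, and Tonelli applies. This links the
    mixed norm to the norm of [L^2] on the product in part B. *)
Lemma norm_xv_diag (p : R) (f : X -> \bar R) : (0 < p)%R -> measurable_fun setT f ->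
  norm_xv p%:E p%:E f = Lnorm mx p%:E f.
Proof.
move=> p0 mf; rewrite /norm_xv unlock /Lnorm; congr (_ `^ _).
have mfp : measurable_fun setT
    (fun z : X => `|f z| `^ p) by exact: measurable_abse_poweR.
transitivity (\int[m]_x \int[m]_v (`|f (x, v)| `^ p)).
  apply: eq_integral => x _; rewrite gee0_abs ?poweR_ge0// -poweRrM mulVf ?gt_eqF//.
  by rewrite poweRe1//; apply: integral_ge0 => v _; exact: poweR_ge0.
apply/esym/(fubini_tonelli1 (m1 := m) (m2 := m) _ mfp) => z; exact: poweR_ge0.
Qed.

(* The adjoint of [f |-> (t |-> U t f)]. *)
Definition superposition G (z : X) : \bar R := \int[leb]_t (G t (shear (- t)%R z))%:E.

Let measurable_pullback G : nonneg_mfun G ->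
  measurable_fun [set: TR * X] (fun w => (G w.1 (shear (- w.1)%R w.2))%:E).
Proof.
move=> [mG _]; apply/measurable_EFinP.
apply: (measurableT_comp mG (g := fun w : TR * X => (w.1, shear (- w.1)%R w.2))).
apply/measurable_fun_pairP; split; first exact: measurable_fst.
apply: (measurableT_comp (@measurable_shear R n)
    (g := fun w : TR * X => ((- w.1)%R, w.2))).
apply/measurable_fun_pairP; split; last exact: measurable_snd.
by apply: measurable_funN; exact: measurable_fst.
Qed.

Lemma superposition_ge0 G z : nonneg_mfun G -> 0 <= superposition G z.
Proof. by move=> [_ G0]; apply: integral_ge0 => t _; rewrite lee_fin. Qed.

Lemma measurable_superposition G : nonneg_mfun G -> measurable_fun setT (superposition G).
Proof.
move=> hG.
apply: (measurable_fun_fubini_tonelli_G (m1 := leb) _ (measurable_pullback hG)).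
by move=> w; rewrite lee_fin; exact: hG.2.
Qed.

Lemma integral_superposition (phi : X -> \bar R) G :
  measurable_fun setT phi -> (forall z, 0 <= phi z) -> nonneg_mfun G ->
  \int[leb]_t \int[mx]_z (phi z * (G t (shear (- t)%R z))%:E) =
  \int[mx]_z (phi z * superposition G z).
Proof.
move=> mphi phi0 hG.
have mk : measurable_fun [set: TR * X]
    (fun w => phi w.2 * (G w.1 (shear (- w.1)%R w.2))%:E).
  apply: emeasurable_funM; last exact: measurable_pullback.
  exact: (measurableT_comp mphi measurable_snd).
transitivity (\int[mx]_z \int[leb]_t (phi z * (G t (shear (- t)%R z))%:E)).
  apply: (fubini_tonelli (m1 := leb) (m2 := sigma_finite_product m m) _ mk).
  by move=> w; rewrite mule_ge0 ?lee_fin//; exact: hG.2.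
apply: eq_integral => z _; rewrite ge0_integralZl//.
- exact: (measurableT_comp (measurable_pullback hG) (pair2_measurable z)).
- by move=> t _; rewrite lee_fin; exact: hG.2.
Qed.

Lemma free_formE f G : measurable_fun setT f -> (forall z, 0 <= f z)%R ->
  nonneg_mfun G ->
  free_form f G = \int[mx]_z ((f z)%:E * superposition G z).
Proof.
move=> mf f0 hG; have mEf : measurable_fun setT (fun z => (f z)%:E).
  exact/measurable_EFinP.
have Ef0 z : 0 <= (f z)%:E by rewrite lee_fin.
rewrite -(integral_superposition mEf Ef0 hG).
apply: eq_integral => t _.
apply: (integral_shear_adjoint t mEf (g := fun z => (G t z)%:E)) => //.
- exact: nonneg_mfun_section.
- by move=> z; rewrite lee_fin; exact: hG.2.
Qed.

Lemma full_formE F G : nonneg_mfun F -> nonneg_mfun G ->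
  full_form F G = \int[mx]_z (superposition F z * superposition G z).
Proof.
move=> hF hG.
rewrite -(integral_superposition (measurable_superposition hF)
    (fun z => superposition_ge0 z hF) hG).
apply: eq_integral => t _; under [RHS]eq_integral do rewrite muleC.
have mGt : measurable_fun setT (fun z : X => (G t (shear (- t)%R z))%:E).
  exact: (measurableT_comp (measurable_pullback hG) (pair1_measurable t)).
have Gt0 (z : X) : 0 <= (G t (shear (- t)%R z))%:E by rewrite lee_fin; exact: hG.2.
rewrite -(integral_superposition mGt Gt0 hF).
apply: eq_integral => s _; rewrite /pairing.
(* Applying [U(-t)] to both factors of the pairing turns them into [U(-s)F(s)] and [U(-t)G(t)]. *)
rewrite -(measure_preserving_integral (measure_preserving_shear n (- t)%R)).
- by apply: eq_integral => z _; rewrite shearD addrAC subrr add0r muleC.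
- exact: (measurableT_comp (measurable_pairing_integrand hF hG)
    (pair1_measurable (s, t))).
- by move=> z; rewrite mule_ge0 ?lee_fin; [|exact: hF.2|exact: hG.2].
Qed.

(** The bridge is that [full_form G G] is the square of the [L^2] norm of [superposition G], so
    bounding the form on the diagonal bounds [superposition]. *)
Lemma bounded_free_form_L2 a1 a2 a3 :
  1 <= a1 -> 1 <= a2 -> 1 <= a3 ->
  bounded_free_form n 2%:E 2%:E a1 a2 a3 <->
  bounded_form (@causal_form R n) a1 a2 a3 a1 a2 a3.
Proof.
move=> a11 a21 a31.
have p2 : (1 <= 2%:E :> \bar R) by rewrite lee_fin ler1n.
have mS F : nonneg_mfun F -> measurable_fun setT (superposition F).
  exact: measurable_superposition.
have S0 F z : nonneg_mfun F -> 0 <= superposition F z by exact: superposition_ge0.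
have holderS (g h : X -> \bar R) : measurable_fun setT g -> measurable_fun setT h ->
    (forall z, 0 <= g z) -> (forall z, 0 <= h z) ->
    \int[mx]_z (g z * h z) <= Lnorm mx 2%:E g * Lnorm mx 2%:E h.
  move=> mg mh g0 h0; have := ge0_hoelder mx p2 mg mh g0 h0.
  by rewrite hoelder_conjugate2.
split=> [[C C0 hC]|bC].
  (* By duality [C] bounds the [L^2] norm of each superposition, and Cauchy-Schwarz multiplies the
     two bounds. *)
  apply: bounded_causal_form_full; exists (C * C)%R; first exact: mulr_gt0.
  have NS F : unit_txv a1 a2 a3 F -> Lnorm mx 2%:E (superposition F) <= C%:E.
    move=> uF; have [hF NF] := uF.
    apply: (Lnorm_dual (nu := sigma_finite_product m m) p2 (mS _ hF)).
      by move=> z; exact: S0.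
    move=> g mg g0; rewrite hoelder_conjugate2 => Ng.
    have Ng' : norm_xv 2%:E 2%:E (EFin \o g) <= 1.
      by rewrite norm_xv_diag//; exact/measurable_EFinP.
    apply: (@le_trans _ _ (free_form g F)).
      rewrite free_formE//.
      by under eq_integral do rewrite muleC.
    apply: (le_trans (hC _ _ mg g0 (le_lt_trans Ng' (ltry 1%R)) uF)).
    by rewrite -[leRHS]mule1; apply: lee_wpmul2l => //; rewrite lee_fin ltW.
  move=> F G uF uG; rewrite (full_formE uF.1 uG.1).
  apply: (le_trans (holderS _ _ (mS _ uF.1) (mS _ uG.1) _ _)).
  - by move=> z; exact: S0 uF.1.
  - by move=> z; exact: S0 uG.1.
  - by rewrite EFinM; apply: lee_pmul; rewrite ?Lnorm_ge0//; exact: NS.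
have [C C0 hC] := bounded_full_form_causal a11 a21 a31 a11 a21 a31 bC.
(* The square root undoes the square in [full_form G G <= C]. *)
exists (C `^ 2^-1)%R; first exact: powR_gt0.
move=> f G mf f0 Nf uG; have hG := uG.1.
rewrite (free_formE mf f0 hG).
have mEf : measurable_fun setT (EFin \o f) by exact/measurable_EFinP.
apply: (le_trans (holderS _ _ mEf (mS _ hG) _ _)).
- by move=> z; rewrite lee_fin.
- by move=> z; exact: S0.
rewrite norm_xv_diag// muleC; apply: lee_wpmul2r; first exact: Lnorm_ge0.
rewrite unlock /Lnorm -poweR_EFin; apply: le_poweR; first by rewrite invr_ge0.
  by apply: integral_ge0 => z _; exact: poweR_ge0.
apply: le_trans (hC _ _ uG uG); rewrite (full_formE hG hG).
apply: ge0_le_integralT => z; first exact: poweR_ge0.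
rewrite gee0_abs ?S0// (_ : 2 = 1 + 1)%R// poweRD ?add_neq0_poweRD_def ?poweRe1 ?S0//.
Qed.

End energy_space.

(** * Equivalence of the estimates *)

Lemma bounded_free_form_iff (R : realType) (n : nat) b c e1 e2 e3 :
  1 <= b -> 1 <= c -> 1 <= e1 -> 1 <= e2 -> 1 <= e3 ->
  bounded_free_form n b c e1 e2 e3 <->
  bounded_form (@causal_form R n) 1 b c e1 e2 e3.
Proof.
move=> b1 c1 e11 e21 e31; split=> h.
  exact/bounded_causal_form_full/bounded_free_form_full.
exact/bounded_form_full_free/bounded_full_form_causal.
Qed.

Local Close Scope ereal_scope.

Theorem theorem2p8 (R : realType) (n : nat) (hn : (1 <= n)%N) :
  (forall q r p b c : \bar R,
    (1 <= q)%E -> (1 <= r)%E -> (1 <= p)%E -> (1 <= b)%E -> (1 <= c)%E ->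
    let q' := hoelder_conjugate q in let r' := hoelder_conjugate r in
    let p' := hoelder_conjugate p in let b' := hoelder_conjugate b in
    let c' := hoelder_conjugate c in
    let homogeneous :=
      lesssim (@L_xv R n b c)
        (fun f => norm_txv q r p (fun t => EFin \o U t f))
        (fun f => norm_xv b c (EFin \o f)) in
    let inhomogeneous :=
      lesssim (@L_txv R n 1%E b c)
        (fun F => norm_txv q r p (W F))
        (fun F => norm_txv 1%E b c (fun t => EFin \o F t)) in
    let dual_inhomogeneous :=
      lesssim (@L_txv R n q' r' p')
        (fun F => norm_txv +oo%E b' c' (W F))
        (fun F => norm_txv q' r' p' (fun t => EFin \o F t)) in
    (homogeneous <-> inhomogeneous) /\ (homogeneous <-> dual_inhomogeneous))
  /\
  (forall q r : \bar R, (1 <= q)%E -> (1 <= r)%E ->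
    let q' := hoelder_conjugate q in let r' := hoelder_conjugate r in
    let lebesgue_xv := (lebesgue_Rn R n \x lebesgue_Rn R n)%E in
    lesssim [set f | f \in Lfun lebesgue_xv 2%:E]
      (fun f => norm_txv q r r' (fun t => EFin \o U t f))
      (fun f => Lnorm lebesgue_xv 2%:E (EFin \o f))
    <->
    lesssim (@L_txv R n q' r' r)
      (fun F => norm_txv q r r' (W F))
      (fun F => norm_txv q' r' r (fun t => EFin \o F t))).
Proof.
split=> [q r p b c q1 r1 p1 b1 c1 q' r' p' b' c' /=|q r q1 r1 q' r' /=].
  have q'1 : (1 <= q')%E := hoelder_conj_ge1 q1.
  have r'1 : (1 <= r')%E := hoelder_conj_ge1 r1.
  have p'1 : (1 <= p')%E := hoelder_conj_ge1 p1.
  have b'1 : (1 <= b')%E := hoelder_conj_ge1 b1.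
  have c'1 : (1 <= c')%E := hoelder_conj_ge1 c1.
  have y1 : (1 <= +oo :> \bar R)%E by rewrite leey.
  have E1 := lesssim_U_bounded_free_form n q1 r1 p1 b1 c1.
  have E2 := bounded_free_form_iff n b1 c1 q'1 r'1 p'1.
  have E3 := lesssim_W_bounded_form n q1 r1 p1 (lexx 1%E) b1 c1.
  (* The triple conjugate to [(+oo, b', c')] is [(1, b, c)]: the third estimate bounds the same
     causal form as the second, with the arguments in the other order. *)
  have E4 := lesssim_W_bounded_form n y1 b'1 c'1 q'1 r'1 p'1.
  rewrite hoelder_conjugatey !hoelder_conjugateK in E4.
  split; first exact: (iff_trans E1 (iff_trans E2 (iff_sym E3))).
  apply: (iff_trans E1 (iff_trans E2 (iff_trans _ (iff_sym E4)))).
  by split; apply: bounded_causal_formC.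
have q'1 : (1 <= q')%E := hoelder_conj_ge1 q1.
have r'1 : (1 <= r')%E := hoelder_conj_ge1 r1.
have two1 : (1 <= 2%:E :> \bar R)%E by rewrite lee_fin ler1n.
have E1 := lesssim_U_bounded_free_form n q1 r1 r'1 two1 two1.
have E2 := lesssim_W_bounded_form n q1 r1 r'1 q'1 r'1 r1.
rewrite hoelder_conjugateK in E1 E2.
apply: iff_trans _ (iff_trans E1 (iff_trans (bounded_free_form_L2 n q'1 r'1 r1) (iff_sym E2))).
(* It remains to identify [L^2] of the product measure, used in the statement of part B, with the
   mixed space at exponents [(2, 2)], both in norm and in membership. *)
have NE (f : Rn R n * Rn R n -> R) : measurable_fun setT f ->
    norm_xv 2%:E 2%:E (EFin \o f) =
    Lnorm (lebesgue_Rn R n \x lebesgue_Rn R n)%E 2%:E (EFin \o f).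
  by move=> mf; apply: norm_xv_diag => //; exact/measurable_EFinP.
have LE (f : Rn R n * Rn R n -> R) :
    f \in Lfun (lebesgue_Rn R n \x lebesgue_Rn R n)%E 2%:E <-> L_xv 2%:E 2%:E f.
  split=> [/andP[]|[mf Nf]].
    by rewrite !inE => mf Nf; split => //; rewrite NE.
  by apply/andP; rewrite !inE; split => //=; rewrite /finite_norm -NE.
split=> -[C C0 hC]; exists C => // f Lf.
  by rewrite NE; [apply: hC; exact/LE|exact: Lf.1].
by move/LE in Lf; rewrite -NE; [exact: hC|exact: Lf.1].
Qed.
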